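(* Let $n\ge1$, $m$ a positive integer, $v=(v_1,\dots,v_n)$ a sequence of nonnegative integers, and $a=(a_1,\dots,a_n)$ a sequence of nonnegative integers with partial sums $\sigma_i=a_1+\cdots+a_i$ and $|a|=\sigma_n$. Define \[ D_{v,(m)}(a)=\mathrm{CT}\bigg[x^{-v}\,h_m\big(x^{(a)}\big)\prod_{1\le i<j\le n}(x_i/x_j;q)_{a_i}(qx_j/x_i;q)_{a_j}\bigg]. \] Then (i) $D_{v,(m)}(a)=0$ if $v^{+}\ne(m)$ (i.e. unless $v$ has exactly one nonzero entry, equal to $m$); and (ii) if $v=(0,\dots,0,m,0,\dots,0)$ with $m$ in position $k$, then \[ D_{v,(m)}(a)=\frac{q^{\sigma_n-\sigma_k}(1-q^{a_k})(q^{|a|};q)_m}{(1-q^{|a|})(q^{|a|-a_k+1};q)_m}\,\frac{(q;q)_{|a|}}{(q;q)_{a_1}\cdots(q;q)_{a_n}}. \]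
   Context: $x=(x_1,\dots,x_n)$, $x^{-v}=\prod_i x_i^{-v_i}$, and $\mathrm{CT}$ is the constant term in $x$. $(a;q)_k=\prod_{i=0}^{k-1}(1-aq^i)$. $x^{(a)}$ denotes the alphabet of $|a|$ variables $(x_1,x_1q,\dots,x_1q^{a_1-1},\dots,x_n,x_nq,\dots,x_nq^{a_n-1})$, and $h_m$ is the $m$-th complete homogeneous symmetric function, $h_m(z_1,\dots,z_N)=\sum_{u_1+\cdots+u_N=m,\,u_i\ge0}z_1^{u_1}\cdots z_N^{u_N}$. $v^{+}$ is the partition obtained by sorting the entries of $v$ in weakly decreasing order and deleting zeros. *)

(* Defs.v *)
From Stdlib Require Import ClassicalEpsilon.
From mathcomp Require Import all_boot all_order all_algebra.
From mathcomp Require Import freeg mpoly.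

Set Implicit Arguments.
Unset Strict Implicit.
Unset Printing Implicit Defensive.

Import GRing.Theory.
Local Open Scope ring_scope.

(* Laurent polynomials in x_1, ..., x_n over F are taken inside the field     *)
(* F(x_1, ..., x_n), where x^{-v} is an honest inverse.                       *)
Notation ratfun F n := {fraction {mpoly F[n]}}.

Definition rf_of (F : fieldType) (n : nat) (p : {mpoly F[n]}) : ratfun F n :=
  FracField.tofrac p.

Definition rf_const (F : fieldType) (n : nat) (c : F) : ratfun F n :=
  rf_of c%:MP.

Definition rf_var (F : fieldType) (n : nat) (i : 'I_n) : ratfun F n :=
  rf_of 'X_i.

(* f is the Laurent polynomial p / x^e, whose constant term is the            *)
(* coefficient of x^e in p.                                                   *)
Definition is_CT (F : fieldType) (n : nat) (f : ratfun F n) (c : F) : Prop :=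
  exists (p : {mpoly F[n]}) (e : 'X_{1..n}),
    f = rf_of p / rf_of 'X_[e] /\ c = p@_e.

(* By CT_eq below, the value does not depend on the presentation p / x^e; it  *)
(* is unspecified when f is not a Laurent polynomial.                         *)
Definition CT (F : fieldType) (n : nat) (f : ratfun F n) : F :=
  epsilon (inhabits 0) (is_CT f).

Lemma rf_ofX_neq0 (F : fieldType) (n : nat) (e : 'X_{1..n}) :
  rf_of ('X_[e] : {mpoly F[n]}) != 0.
Proof. by rewrite /rf_of tofrac_eq0 -msupp_eq0 msuppX. Qed.

Lemma is_CT_uniq (F : fieldType) (n : nat) (f : ratfun F n) (c d : F) :
  is_CT f c -> is_CT f d -> c = d.
Proof.
move=> [p [e [-> ->]]] [r [k [E ->]]]; move/eqP: E.
rewrite GRing.eqr_div ?rf_ofX_neq0 // /rf_of -!tofracM tofrac_eq => /eqP.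
move/(congr1 (mcoeff (e + k)%MM)).
by rewrite [in LHS]addmC !mcoeffMX.
Qed.

Lemma CT_eq (F : fieldType) (n : nat) (p : {mpoly F[n]}) (e : 'X_{1..n}) :
  CT (rf_of p / rf_of 'X_[e]) = p@_e.
Proof.
have ex : is_CT (rf_of p / rf_of 'X_[e]) p@_e by exists p, e.
by apply: (is_CT_uniq _ ex); apply: epsilon_spec; exists p@_e.
Qed.

(* (a; q)_k *)
Definition qpoch (R : comNzRingType) (a q : R) (k : nat) : R :=
  \prod_(i < k) (1 - a * q ^+ i).

(* h_m(z_1, ..., z_N) for the alphabet z; each exponent is at most m.         *)
Definition hsym (R : comNzRingType) (m : nat) (z : seq R) : R :=
  \sum_(u : {ffun 'I_(size z) -> 'I_m.+1} | (\sum_i u i)%N == m)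
    \prod_(i < size z) z`_i ^+ u i.

(* x^{(a)} *)
Definition qalphabet (F : fieldType) (n : nat) (q : F) (a : 'I_n -> nat) :
    seq (ratfun F n) :=
  [seq rf_var F i * rf_const n q ^+ j | i <- enum 'I_n, j <- iota 0 (a i)].

(* sigma_k = a_1 + ... + a_k, the sum of the first k entries *)
Definition psum (n : nat) (a : 'I_n -> nat) (k : nat) : nat :=
  (\sum_(i < n | i < k) a i)%N.

(* v^+ *)
Definition plus_part (n : nat) (v : 'I_n -> nat) : seq nat :=
  sort geq [seq c <- codom v | c != 0%N].

(* D_{v,(m)}(a) *)
Definition Dcoef (F : fieldType) (n : nat) (q : F)
    (v : 'I_n -> nat) (m : nat) (a : 'I_n -> nat) : F :=
  let x := @rf_var F n in
  let q' := rf_const n q in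
  CT ((\prod_(i < n) x i ^- v i) * hsym m (qalphabet q a) *
      \prod_(i < n) \prod_(j < n | (i < j)%N)
        (qpoch (x i / x j) q' (a i) * qpoch (q' * x j / x i) q' (a j))).

(* Main.v *)
(* The constant term is the coefficient of x^e, e_i = v_i + |a| - a_i, in the
   polynomial h_m(x^(a)) F, where F is the homogenised q-Dyson product; as
   deg = |e|, this is a top coefficient, so by the combinatorial Nullstellensatz
   it only depends on the values on the grid x_i = q^(al_i), 0 <= al_i <= e_i.
   There F vanishes unless the intervals [al_i, al_i + a_i) are disjoint (Karolyi
   and Nagy). Without changing the top coefficient, h_m may be replaced by the
   coefficient of t^m in prod_(s < |a|+m-1) (1 - q^s t) / prod_i (x_i t; q)_(a_i).
   If the disjoint intervals lie in [0, |a|+m-1), the quotient is a polynomial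
   of degree m - 1 and that coefficient is zero, which gives the vanishing part.
   If v = m e_k, the surviving points have al_k = e_k, and there the product
   agrees with a constant times the q-Dyson product of the other variables, a
   Lagrange factor in x_k and univariate factors in the other x_j, which reduces
   the evaluation to the q-Dyson identity. As q may be 0, everything is done at
   q = X over F(X) and specialised. *)
Require Import Defs.
From mathcomp Require Import all_boot all_order all_algebra.
From mathcomp Require Import freeg mpoly.
From mathcomp Require Import zify ring.

Set Implicit Arguments.
Unset Strict Implicit.
Unset Printing Implicit Defensive.

Import GRing.Theory.
Local Open Scope ring_scope.

(** * Top coefficients and grids *)

(** The weights are the last column of an inverse Vandermonde matrix, so that summing values against
    them reads off the coefficient of degree [d]. *)
Lemma lagrange_weights (K : fieldType) (g : nat -> K) (d : nat) :
  injective g ->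
  exists w : nat -> K, forall j, (j <= d)%N ->
    \sum_(s < d.+1) w s * g s ^+ j = (j == d)%:R.
Proof.
move=> inj_g; pose V := Vandermonde d.+1 (\row_(s < d.+1) g s).
have Vu : V \in unitmx.
  rewrite unitmxE det_Vandermonde unitfE; apply/prodf_neq0 => i _.
  apply/prodf_neq0 => j lt_ij; rewrite !mxE subr_eq0 (inj_eq inj_g).
  by rewrite neq_ltn lt_ij orbT.
pose w := invmx V *m delta_mx ord_max (0 : 'I_1).
exists (fun s => w (inord s) 0) => j le_jd.
have jE : (inord j : 'I_d.+1) = j :> nat by rewrite inordK.
have <- : (V *m w) (inord j) 0 = (j == d)%:R.
  rewrite /w mulKVmx // mxE eqxx andbT.
  by rewrite -val_eqE /= jE.
rewrite mxE; apply: eq_bigr => s _.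
by rewrite !mxE jE mulrC inord_val.
Qed.

Lemma mdeg_lt_coord (n : nat) (d e : 'X_{1..n}) :
  (mdeg d <= mdeg e)%N -> d != e -> exists i, (d i < e i)%N.
Proof.
move=> le_de ne_de; apply/existsP; apply: contraNT ne_de => /existsPn le_ed.
have le_edi i : (e i <= d i)%N by rewrite leqNgt le_ed.
rewrite eq_sym; apply/eqP/mnmP => i; apply/eqP.
rewrite eqn_leq le_edi /=; move: le_de; rewrite !mdegE.
rewrite (bigD1 i) //= [X in (_ <= X)%N](bigD1 i) //=.
have : (\sum_(j | j != i) e j <= \sum_(j | j != i) d j)%N by apply: leq_sum.
by move: (\sum_(j | _) e j)%N (\sum_(j | _) d j)%N (d i) (e i) => ? ? ? ?; lia.
Qed.

Lemma sum_eval_weights (K : fieldType) (n M : nat) (P : {mpoly K[n]})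
    (w : 'I_n -> 'I_M -> K) (g : 'I_M -> K) :
  \sum_(f : {ffun 'I_n -> 'I_M}) (\prod_i w i (f i)) * P.@[fun i => g (f i)] =
  \sum_(d <- msupp P) P@_d * \prod_i \sum_(s < M) w i s * g s ^+ d i.
Proof.
under eq_bigr => f _ do rewrite mevalE mulr_sumr.
rewrite exchange_big /=; apply: eq_bigr => d _.
rewrite bigA_distr_bigA mulr_sumr /=; apply: eq_bigr => f _.
by rewrite big_split /= mulrCA.
Qed.

(* The coefficient of a top monomial x^e is a linear combination of the values
   on any grid with [e_i + 1] points in direction [i]. *)
Lemma combinatorial_nullstellensatz (K : fieldType) (n : nat)
    (g : nat -> K) (P : {mpoly K[n]}) (e : 'X_{1..n}) :
  injective g -> (msize P <= (mdeg e).+1)%N ->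
  (forall al : 'I_n -> nat, (forall i, al i <= e i)%N ->
     P.@[fun i => g (al i)] = 0) ->
  P@_e = 0.
Proof.
move=> inj_g szP P0.
have /fin_all_exists [w wP] : forall i : 'I_n, exists w : nat -> K,
    forall j, (j <= e i)%N ->
    \sum_(s < (e i).+1) w s * g s ^+ j = (j == e i)%:R.
  by move=> i; apply: lagrange_weights.
(* All directions share the range [M], which exceeds every [e i]; [W] extends the weights of
   direction [i] by zero beyond [e i]. *)
pose M := (mdeg e).+1.
pose W i (s : 'I_M) := if (s <= e i)%N then w i s else 0.
have WE i j : (j <= e i)%N ->
    \sum_(s < M) W i s * g s ^+ j = (j == e i)%:R.
  move=> le_je; rewrite -wP //.
  have le_eM : ((e i).+1 <= M)%N by rewrite ltnS mdegE (bigD1 i) //= leq_addr.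
  rewrite (big_ord_widen M (fun s => w i s * g s ^+ j)) // [RHS]big_mkcond /=.
  apply: eq_bigr => s _; rewrite /W ltnS.
  by case: ifP; rewrite ?mul0r.
have := sum_eval_weights P W (fun s => g s).
rewrite big1 => [|f _]; last first.
  have [le_fe|] := boolP [forall i, (f i <= e i)%N].
    by rewrite P0 ?mulr0 // => i; apply: (forallP le_fe).
  rewrite negb_forall => /existsP[i Ni].
  by rewrite (bigD1 i) //= /W (negbTE Ni) !mul0r.
move=> /esym E0.
have coef0 d : d \in msupp P -> d != e ->
    P@_d * \prod_i \sum_(s < M) W i s * g s ^+ d i = 0.
  move=> d_in ne_de.
  have le_d : (mdeg d <= mdeg e)%N.
    by rewrite -ltnS; apply: leq_trans (msize_mdeg_lt d_in) szP.
  have [i lt_i] := mdeg_lt_coord le_d ne_de.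
  by rewrite (bigD1 i) //= WE ?(ltnW lt_i) // (ltn_eqF lt_i) mul0r mulr0.
have [e_in|] := boolP (e \in msupp P); last by move/memN_msupp_eq0.
move: E0; rewrite (bigD1_seq e) ?msupp_uniq //= [X in _ + X]big_seq_cond.
rewrite [X in _ + X]big1 ?addr0 => [|d /andP[? ?]]; last exact: coef0.
rewrite (eq_bigr (fun=> 1)) => [|i _]; last by rewrite WE ?eqxx.
by rewrite big1_eq mulr1.
Qed.

Lemma msize_le (K : comNzRingType) (n : nat) (p : {mpoly K[n]}) (k : nat) :
  (forall d, d \in msupp p -> (mdeg d < k)%N) -> (msize p <= k)%N.
Proof. by move=> ltk; rewrite msizeE; apply/bigmax_leqP_seq => d /ltk. Qed.

(** The value [c] may be zero: [mdeg d] only bounds the degree of [Q]. The predicate is stable under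
    multiplication by factors whose leading part is a monomial. *)
Definition has_top (K : comNzRingType) (n : nat) (Q : {mpoly K[n]})
    (d : 'X_{1..n}) (c : K) : Prop :=
  (msize Q <= (mdeg d).+1)%N /\ Q@_d = c.

Lemma has_top1 (K : comNzRingType) (n : nat) : has_top (1 : {mpoly K[n]}) 0%MM 1.
Proof. by split; rewrite ?msize1 // mcoeff1 eqxx. Qed.

Lemma has_topZ (K : comNzRingType) (n : nat) (Q : {mpoly K[n]}) d c k :
  has_top Q d c -> has_top (k *: Q) d (k * c).
Proof.
move=> [szQ <-]; split; last by rewrite mcoeffZ.
exact: leq_trans (msizeZ_le _ _) szQ.
Qed.

(** The constant [r] only contributes terms of degree at most [mdeg d], below the new top degree. *)
Lemma has_top_linear (K : comNzRingType) (n : nat) (Q : {mpoly K[n]}) d c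
    (j : 'I_n) (b r : K) :
  has_top Q d c -> has_top (Q * (b *: 'X_j - r%:MP)) (d + U_(j))%MM (b * c).
Proof.
move=> [szQ <-]; have mdE : mdeg (d + U_(j))%MM = (mdeg d).+1.
  by rewrite mdegD mdeg1 addn1.
have -> : Q * (b *: 'X_j - r%:MP) = b *: (Q * 'X_j) - r *: Q.
  by rewrite mulrBr -scalerAr [Q * r%:MP]mulrC mul_mpolyC.
split.
  apply: leq_trans (msizeD_le _ _) _; rewrite geq_max msizeN mdE.
  rewrite (leq_trans (msizeZ_le _ _)) /=; last first.
    apply: msize_le => h; rewrite (perm_mem (msuppMX _ _)) => /mapP[h' h'in ->].
    by rewrite mdegD mdeg1 add1n ltnS (leq_trans (msize_mdeg_lt h'in)).
  by rewrite (leq_trans (msizeZ_le _ _)) // (leq_trans szQ) // ltnS.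
rewrite mcoeffB !mcoeffZ [X in _ - r * X]memN_msupp_eq0.
  by rewrite mulr0 subr0 addmC mcoeffMX.
by apply: msize_mdeg_ge; rewrite mdE.
Qed.

Lemma has_top_linears (K : comNzRingType) (n : nat) (Q : {mpoly K[n]}) d c
    (j : 'I_n) (b : K) (r : nat -> K) (N : nat) :
  has_top Q d c ->
  has_top (Q * \prod_(t < N) (b *: 'X_j - (r t)%:MP)) (d + U_(j) *+ N)%MM
    (b ^+ N * c).
Proof.
move=> topQ; elim: N => [|N IHN].
  by rewrite big_ord0 mulr1 mul1r mulm0n addm0.
rewrite big_ord_recr /= mulrA exprS -(mulrA b) mulmSr addmA.
exact: has_top_linear.
Qed.

Lemma has_top_fun (K : comNzRingType) (n : nat) (I : Type) (s : seq I)
    (P : pred I) (G : I -> {mpoly K[n]}) (E : I -> 'X_{1..n}) (b : I -> K) Q d c :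
  (forall i Q d c, P i -> has_top Q d c -> has_top (Q * G i) (d + E i)%MM (b i * c)) ->
  has_top Q d c ->
  has_top (Q * \prod_(i <- s | P i) G i) (d + \sum_(i <- s | P i) E i)%MM
    ((\prod_(i <- s | P i) b i) * c).
Proof.
move=> topG; elim: s Q d c => [|i s IHs] Q d c topQ.
  by rewrite !big_nil mulr1 mul1r addm0.
rewrite !big_cons; case: ifP => Pi; last exact: IHs.
rewrite mulrA addmA [b i * _]mulrC -(mulrA _ (b i)); apply/IHs/topG => //.
Qed.

(** * Complete homogeneous symmetric functions *)

(** The series 1/(1 - xX) truncated after X^m, which keeps the generating function of the h_j inside
    polynomials. *)
Definition geom (R : comNzRingType) (m : nat) (x : R) : {poly R} :=
  \poly_(u < m.+1) x ^+ u.

Lemma geomM (R : comNzRingType) (m : nat) (x : R) :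
  geom m x * (1 - x *: 'X) = 1 - x ^+ m.+1 *: 'X^(m.+1).
Proof.
rewrite -exprZn -[RHS]opprB subrX1 -mulNr opprB mulrC /geom poly_def.
by congr (_ * _); apply: eq_bigr => i _; rewrite exprZn.
Qed.

Lemma map_geom (R S : comNzRingType) (f : {rmorphism R -> S}) (m : nat) (x : R) :
  map_poly f (geom m x) = geom m (f x).
Proof.
apply/polyP => i; rewrite coef_map !coef_poly; case: ifP => _.
  exact: rmorphXn.
exact: rmorph0.
Qed.

Lemma hsym_geom (R : comNzRingType) (m : nat) (z : seq R) :
  hsym m z = (\prod_(x <- z) geom m x)`_m.
Proof.
rewrite /hsym [in RHS](big_nth 0) big_mkord.
under [in RHS]eq_bigr => i _ do rewrite /geom poly_def.
rewrite bigA_distr_bigA /= coef_sum big_mkcond /=; apply: eq_bigr => u _.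
rewrite [in RHS](eq_bigr (fun i : 'I_(size z) => (z`_i ^+ u i)%:P * 'X^(u i))) => [|i _]; last first.
  by rewrite mul_polyC.
rewrite big_split /= -rmorph_prod /= mul_polyC coefZ prodrXr coefXn eq_sym.
by case: eqP; rewrite ?mulr1 ?mulr0.
Qed.

Lemma map_hsym (R S : comNzRingType) (f : {rmorphism R -> S}) (m : nat) (z : seq R) :
  f (hsym m z) = hsym m [seq f x | x <- z].
Proof.
rewrite !hsym_geom -coef_map rmorph_prod big_map /=.
by under eq_bigr => x _ do rewrite map_geom.
Qed.

(* Modulo X^(m+1), [geom m x] is the inverse of [1 - x X]. *)
Lemma coef_prod_geomM (R : comNzRingType) (m : nat) (s : seq R) (Q : {poly R}) :
  ((\prod_(x <- s) geom m x) * ((\prod_(x <- s) (1 - x *: 'X)) * Q))`_m = Q`_m.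
Proof.
elim: s Q => [|x s IHs] Q; first by rewrite !big_nil !mul1r.
rewrite !big_cons -[X in _ * X]mulrA mulrACA geomM mulrBl mul1r coefB IHs.
by rewrite -scalerAl coefZ coefXnM ltnSn mulr0 subr0.
Qed.

(** For Q = prod (1 - bX) of degree at most j, the coefficient of X^j in Q/(1 - cX) is c^j Q(1/c);
    the formula is this value with denominators cleared. *)
Lemma coef_geom_linears (R : comNzRingType) (m j : nat) (c : R) (s : seq R) :
  (size s <= j <= m)%N ->
  (geom m c * \prod_(b <- s) (1 - b *: 'X))`_j =
    c ^+ (j - size s) * \prod_(b <- s) (c - b).
Proof.
elim: s j => [|b s IHs] j /andP[le_sj le_jm].
  by rewrite !big_nil !mulr1 coef_poly ltnS le_jm subn0.
rewrite !big_cons mulrCA mulrBl mul1r -scalerAl coefB coefZ coefXM.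
case: j le_sj le_jm => [//|j] /= le_sj le_jm.
rewrite !IHs ?(ltnW le_jm) ?andbT //; last by rewrite ltnW.
by rewrite subSS subSn // exprS; ring.
Qed.

Lemma homog_coef_prod_geom (R : comNzRingType) (n m : nat)
    (z : seq {mpoly R[n]}) (j : nat) :
  {in z, forall x, x \is 1.-homog} ->
  (\prod_(x <- z) geom m x)`_j \is j.-homog.
Proof.
elim: z j => [|x z IHz] j homz.
  by rewrite big_nil coef1; case: eqP => [->|_]; rewrite ?dhomog1 ?dhomog0.
rewrite big_cons coefM; apply: rpred_sum => i _.
suff : (geom m x)`_i * (\prod_(y <- z) geom m y)`_(j - i) \is (i + (j - i)).-homog.
  by rewrite subnKC // -ltnS.
apply: dhomogM; last first.
  by apply: IHz => y yz; apply: homz; rewrite in_cons yz orbT.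
rewrite coef_poly; case: ifP => _; last exact: dhomog0.
by rewrite -[X in X.-homog]mul1n; apply: dhomogMn; apply: homz; rewrite mem_head.
Qed.

(* h_m(z - B) in plethystic notation, an inhomogeneous deformation of h_m(z). *)
Definition hshift (R : comNzRingType) (n m : nat) (z : seq {mpoly R[n]})
    (B : seq R) : {mpoly R[n]} :=
  ((\prod_(x <- z) geom m x) * \prod_(b <- B) (1 - b%:MP *: 'X))`_m.

Lemma meval_hshift (R : comNzRingType) (n m : nat) (z : seq {mpoly R[n]})
    (B : seq R) (pt : 'I_n -> R) :
  (hshift m z B).@[pt] =
  ((\prod_(x <- z) geom m x.@[pt]) * \prod_(b <- B) (1 - b *: 'X))`_m.
Proof.
rewrite /hshift -(coef_map (meval pt)) rmorphM !rmorph_prod /=.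
congr (_`_m); congr polyseq; congr (_ * _); apply: eq_bigr => x _; first by rewrite map_geom.
by rewrite rmorphB rmorph1 /= map_polyZ map_polyX /= mevalC.
Qed.

(** Expanding in the letters of [B] writes [hshift] as a combination of h_j(z) for j <= m. Only j =
    m reaches the top degree, and its coefficient is the constant term 1 of the product over [B]. *)
Lemma has_top_hshift (R : comNzRingType) (n m d : nat) (z : seq {mpoly R[n]})
    (B : seq R) (Q : {mpoly R[n]}) (e : 'X_{1..n}) :
  {in z, forall x, x \is 1.-homog} -> Q \is d.-homog ->
  mdeg e = (m + d)%N ->
  has_top (hshift m z B * Q) e (hsym m z * Q)@_e.
Proof.
move=> homz homQ eE; pose p := \prod_(x <- z) geom m x.
pose be := \prod_(b <- B) (1 - b *: 'X).
have be0 : be`_0 = 1.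
  rewrite /be -horner_coef0 horner_prod big1 //= => b _.
  by rewrite !hornerE ?mulr0 ?oppr0 ?addr0 ?subr0.
have hE : hshift m z B = \sum_(j < m.+1) be`_(m - j) *: p`_j.
  rewrite /hshift coefM; apply: eq_bigr => j _; rewrite -mul_mpolyC mulrC.
  rewrite -(coef_map (@mpolyC n R)) /= rmorph_prod /=; congr (_`_ _ * _); congr polyseq.
  by apply: eq_bigr => b _; rewrite rmorphB rmorph1 /= map_polyZ map_polyX.
have cE h : (hshift m z B * Q)@_h = \sum_(j < m.+1) be`_(m - j) * (p`_j * Q)@_h.
  rewrite hE mulr_suml raddf_sum; apply: eq_bigr => j _.
  by rewrite -scalerAl /= mcoeffZ.
have c0 (j : nat) h : mdeg h <> (j + d)%N -> (p`_j * Q)@_h = 0.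
  move=> neq; apply: (@dhomog_nemf_coeff _ _ mdeg (j + d)); last exact/eqP.
  exact/dhomogM/homQ/homog_coef_prod_geom.
split.
  apply: msize_le => h; rewrite mcoeff_msupp; apply: contraR; rewrite -leqNgt => lt_eh.
  rewrite cE big1 // => j _; rewrite c0 ?mulr0 //.
  by move: (ltn_ord j) lt_eh; rewrite eE; lia.
rewrite cE big_ord_recr /= subnn be0 mul1r hsym_geom big1 ?add0r // => j _.
by rewrite c0 ?mulr0 // eE; move: (ltn_ord j); lia.
Qed.

(** * Disjoint intervals *)

(* The lexicographic order on (al i, i), encoded in nat. *)
Definition lexkey (n : nat) (al : 'I_n -> nat) (i : 'I_n) : nat := (al i * n + i)%N.

(* The intervals [al i, al i + a i) are pairwise disjoint, with an extra gap
   after [i] whenever an interval of smaller index lies further to the right. *)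
Definition separated (n : nat) (S : {set 'I_n}) (a al : 'I_n -> nat) : Prop :=
  {in S &, forall i j, (lexkey al i < lexkey al j)%N ->
    (al i + a i + (j < i) <= al j)%N}.

Lemma lexkey_inj (n : nat) (al : 'I_n -> nat) : injective (lexkey al).
Proof.
move=> i j; rewrite /lexkey => E; apply: val_inj => /=.
have := congr1 (modn^~ n) E; rewrite !modnMDl !modn_small //.
Qed.

Lemma lexkey_ltP (n : nat) (al : 'I_n -> nat) (i j : 'I_n) :
  (lexkey al i < lexkey al j)%N -> (al i < al j)%N \/ al i = al j /\ (i < j)%N.
Proof.
rewrite /lexkey => lt_ij; case: (ltngtP (al i) (al j)) => [?|lt_ji|eq_ij].
- by left.
- by have := leq_mul2r n (al j).+1 (al i); rewrite lt_ji orbT mulSn; move: (ltn_ord j); lia.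
- by right; split=> //; move: lt_ij; rewrite eq_ij ltn_add2l.
Qed.

Lemma separatedS (n : nat) (S T : {set 'I_n}) (a al : 'I_n -> nat) :
  T \subset S -> separated S a al -> separated T a al.
Proof. by move=> /subsetP sTS sep i j /sTS iS /sTS jS; apply: sep. Qed.

Lemma separated_split (n : nat) (S : {set 'I_n}) (al : 'I_n -> nat)
    (a : 'I_n -> nat) (i : 'I_n) : i \in S ->
  (\sum_(j in S) a j =
   a i + \sum_(j in [set j in S | lexkey al j < lexkey al i]) a j +
     \sum_(j in [set j in S | lexkey al i < lexkey al j]) a j)%N.
Proof.
move=> iS; rewrite (bigD1 i) //= -addnA; congr addn.
rewrite (bigID (fun j => lexkey al j < lexkey al i)%N) /=.
congr addn; apply: eq_bigl => j; rewrite inE;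
  case: (ltngtP (lexkey al j) (lexkey al i)) => [lt|lt|/lexkey_inj->];
  rewrite ?andbF ?andbT ?eqxx ?andbF //.
- by case: eqP lt => [->|]; rewrite ?ltnn ?andbT.
- by case: eqP lt => [->|]; rewrite ?ltnn ?andbT.
Qed.

(** Induction on the cardinality: any [i] in [S] splits the other intervals into those inside [L, al
    i) and those inside [al i + a i, U). *)
Lemma separated_sum_le (n : nat) (S : {set 'I_n}) (a al : 'I_n -> nat) (L U : nat) :
  separated S a al -> (L <= U)%N ->
  {in S, forall i, (L <= al i)%N && (al i + a i <= U)%N} ->
  (L + \sum_(i in S) a i <= U)%N.
Proof.
have [k le_Sk] := ubnP #|S|.
elim: k S L U le_Sk => [//|k IHk] S L U; rewrite ltnS => le_Sk sep leLU bnd.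
have [->|[i iS]] := set_0Vmem S; first by rewrite big_set0 addn0.
have /andP[leLi leiU] := bnd i iS.
rewrite (separated_split al a iS).
set S1 := [set j in S | _]; set S2 := [set j in S | _].
have proper1 (T : {set 'I_n}) : T \subset S -> i \notin T -> (#|T| < k)%N.
  move=> sTS iT; apply: leq_trans le_Sk; apply: proper_card.
  by rewrite properE sTS; apply/subsetPn; exists i.
have s1 : S1 \subset S by apply/subsetP => j; rewrite inE => /andP[].
have s2 : S2 \subset S by apply/subsetP => j; rewrite inE => /andP[].
have h1 : (L + \sum_(j in S1) a j <= al i)%N.
  apply: IHk => //; first by apply: proper1; rewrite // inE ltnn andbF.
    exact: separatedS sep.
  move=> j; rewrite inE => /andP[jS lt_ji]; have /andP[-> _] := bnd j jS.
  by have := sep j i jS iS lt_ji; rewrite /=; lia.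
have h2 : (al i + a i + \sum_(j in S2) a j <= U)%N.
  apply: IHk => //; first by apply: proper1; rewrite // inE ltnn andbF.
    exact: separatedS sep.
  move=> j; rewrite inE => /andP[jS lt_ij]; have /andP[_ ->] := bnd j jS.
  by have := sep i j iS jS lt_ij; rewrite andbT; lia.
by move: h1 h2; lia.
Qed.

(** The window is exactly as long as the intervals together, so they are packed without holes in the
    order of [lexkey]. The extra gaps in [separated] then exclude any descent, and that order is the
    order of the indices. *)
Lemma separated_position (n : nat) (S : {set 'I_n}) (a al : 'I_n -> nat) :
  separated S a al ->
  {in S, forall i, (al i + a i <= \sum_(j in S) a j)%N} ->
  {in S, forall i, al i = (\sum_(j in S | (j < i)%N) a j)%N}.
Proof.
move=> sep bnd.
pose S1 i := [set j in S | (lexkey al j < lexkey al i)%N].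
pose S2 i := [set j in S | (lexkey al i < lexkey al j)%N].
have s1 i : S1 i \subset S by apply/subsetP => j; rewrite inE => /andP[].
have s2 i : S2 i \subset S by apply/subsetP => j; rewrite inE => /andP[].
have pos i : i \in S -> al i = (\sum_(j in S1 i) a j)%N.
  move=> iS; apply/eqP; rewrite eqn_leq andbC.
  have h1 : (0 + \sum_(j in S1 i) a j <= al i)%N.
    apply: (separated_sum_le (separatedS (s1 i) sep)) => // j.
    rewrite inE => /andP[jS lt_ji]; have := sep j i jS iS lt_ji; rewrite /=; lia.
  have h2 : (al i + a i + \sum_(j in S2 i) a j <= \sum_(j in S) a j)%N.
    apply: (separated_sum_le (separatedS (s2 i) sep)) => //; first exact: bnd.
    move=> j; rewrite inE => /andP[jS lt_ij]; rewrite bnd // andbT.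
    by have := sep i j iS jS lt_ij; lia.
  have := separated_split al a iS.
  by rewrite -/(S1 i) -/(S2 i); move: h1 h2; lia.
(* At the first descent [j] after [i], every earlier interval ends strictly
   before [al j], leaving a hole that the total length does not allow. *)
have nodesc i j : i \in S -> j \in S -> (j < i)%N -> (lexkey al j < lexkey al i)%N.
  move=> iS jS lt_ji; rewrite ltnNge leq_eqVlt negb_or.
  apply/andP; split.
    by apply/eqP => /lexkey_inj E; rewrite E ltnn in lt_ji.
  apply/negP => lt_key; pose D l := [&& l \in S, (l < i)%N & (lexkey al i < lexkey al l)%N].
  have Dj : D j by rewrite /D jS lt_ji lt_key.
  have [{lt_ji lt_key}{}j /and3P[{Dj}{}jS lt_ji lt_key] minj] := arg_minnP (lexkey al) Dj.
  have lt_al : (al i + a i < al j)%N.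
    by have := sep i j iS jS lt_key; rewrite lt_ji addn1.
  have : (0 + \sum_(l in S1 j) a l <= (al j).-1)%N.
    apply: (separated_sum_le (separatedS (s1 j) sep)) => // l.
    rewrite inE => /andP[lS lt_lj] /=.
    have [lt_li|lt_il|/lexkey_inj->] := ltngtP (lexkey al l) (lexkey al i); last lia.
      by have := sep l i lS iS lt_li; lia.
    (* Minimality of [j] gives [i <= l], so [l] has larger index than [j] and its separation from
       [j] includes the extra unit. *)
    have lt_jl : (j < l)%N.
      apply: leq_trans lt_ji _; rewrite leqNgt; apply/negP => lt_li.
      have /minj : D l by rewrite /D lS lt_li lt_il.
      by rewrite leqNgt lt_lj.
    by have := sep l j lS jS lt_lj; rewrite lt_jl; lia.
  by rewrite -pos //; move: lt_al; lia.
move=> i iS; rewrite pos //; apply: eq_bigl => j; rewrite inE.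
case jS: (j \in S) => //=; have [lt_ji|lt_ij|/val_inj->] := ltngtP j i.
- exact: nodesc.
- by apply/negbTE; rewrite -leqNgt ltnW // nodesc.
- by rewrite ltnn.
Qed.

(** The exponents of q in the alphabet x^(a), restricted to the indices in [s], at the grid point
    x_i = q^(al i). *)
Definition strings (n : nat) (a al : 'I_n -> nat) (s : seq 'I_n) : seq nat :=
  [seq (al i + t)%N | i <- s, t <- iota 0 (a i)].

Lemma strings_uniq (n : nat) (S : {set 'I_n}) (a al : 'I_n -> nat) (s : seq 'I_n) :
  separated S a al -> uniq s -> {subset s <= S} -> uniq (strings a al s).
Proof.
move=> sep; elim: s => [//|i s IHs] /= /andP[i_s us] sS.
rewrite /strings allpairs_cons cat_uniq.
have iS : i \in S by apply: sS; rewrite mem_head.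
have sS' : {subset s <= S} by move=> j js; apply: sS; rewrite in_cons js orbT.
rewrite IHs // andbT map_inj_uniq ?iota_uniq /=; last exact: addnI.
apply/hasPn => x /allpairsPdep[j [t [js]]]; rewrite mem_iota add0n => lt_t ->.
apply/negP => /mapP[t']; rewrite mem_iota add0n => lt_t' E.
have jS := sS' j js.
have [lt|lt|/lexkey_inj eq_ij] := ltngtP (lexkey al i) (lexkey al j).
- by have := sep i j iS jS lt; move: lt_t lt_t' E => /=; lia.
- by have := sep j i jS iS lt; move: lt_t lt_t' E => /=; lia.
- by rewrite eq_ij js in i_s.
Qed.

(** * The q-Dyson product *)

(** The Nullstellensatz applied to [P - Q]. Every evaluation below replaces a product by a simpler
    polynomial with the same values on the grid. *)
Lemma has_top_coef_eq (K : fieldType) (n : nat) (g : nat -> K)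
    (P Q : {mpoly K[n]}) (e : 'X_{1..n}) (c d : K) :
  injective g -> has_top P e c -> has_top Q e d ->
  (forall al : 'I_n -> nat, (forall i, al i <= e i)%N ->
     P.@[fun i => g (al i)] = Q.@[fun i => g (al i)]) ->
  c = d.
Proof.
move=> inj_g [szP <-] [szQ <-] eqPQ; apply/eqP; rewrite -subr_eq0 -mcoeffB.
apply/eqP; apply: (combinatorial_nullstellensatz inj_g) => [|al le_al].
  by apply: leq_trans (msizeD_le _ _) _; rewrite geq_max msizeN szP.
by rewrite mevalB eqPQ // subrr.
Qed.

Lemma homog_bigprod (R : comNzRingType) (n : nat) (I : Type) (s : seq I)
    (P : pred I) (G : I -> {mpoly R[n]}) (d : I -> nat) :
  (forall i, P i -> G i \is (d i).-homog) ->
  \prod_(i <- s | P i) G i \is (\sum_(i <- s | P i) d i)%N.-homog.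
Proof.
move=> homG; elim/big_rec2: _ => [|i D Q Pi homQ]; first exact: dhomog1.
exact/dhomogM/homQ/homG.
Qed.

(* For x = x_i, y = x_j this is (x_i/x_j;q)_a (q x_j/x_i;q)_b x_j^a x_i^b. *)
Definition dyson_pair (R : comNzRingType) (q x y : R) (a b : nat) : R :=
  (\prod_(t < a) (y - x * q ^+ t)) * \prod_(t < b) (x - y * q ^+ t.+1).

Lemma rmorph_dyson_pair (R S : comNzRingType) (f : {rmorphism R -> S})
    (q x y : R) (a b : nat) :
  f (dyson_pair q x y a b) = dyson_pair (f q) (f x) (f y) a b.
Proof.
rewrite /dyson_pair rmorphM !rmorph_prod.
by congr (_ * _); apply: eq_bigr => t _; rewrite rmorphB rmorphM rmorphXn.
Qed.

Lemma homog_dyson_pair (R : comNzRingType) (n : nat) (q : R) (i j : 'I_n) (a b : nat) :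
  dyson_pair q%:MP 'X_i 'X_j a b \is [in R[n], (a + b).-homog].
Proof.
have homX (l : 'I_n) : 'X_l \is [in R[n], 1.-homog] by rewrite dhomogX /= mdeg1.
have hom_lin (l k : 'I_n) t : 'X_l - 'X_k * q%:MP ^+ t \is [in R[n], 1.-homog].
  rewrite -rmorphXn /= mulrC mul_mpolyC.
  by apply: rpredB => //; apply: rpredZ.
apply: dhomogM; rewrite -[X in X.-homog]card_ord -sum1_card.
  by apply: homog_bigprod => t _.
by apply: homog_bigprod => t _.
Qed.

Definition dyson (R : comNzRingType) (n : nat) (q : R) (S : {set 'I_n})
    (a : 'I_n -> nat) : {mpoly R[n]} :=
  \prod_(i in S) \prod_(j in S | (i < j)%N)
    dyson_pair q%:MP 'X_i 'X_j (a i) (a j).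

(** The monomial clearing the denominators of the q-Dyson product over [S]: the constant term of
    that product is the coefficient of [dyson] here. *)
Definition dyson_exp (n : nat) (S : {set 'I_n}) (a : 'I_n -> nat) : 'X_{1..n} :=
  [multinom (if i \in S then \sum_(j in S | j != i) a j else 0)%N | i < n].

Lemma dyson_exp_addn (n : nat) (S : {set 'I_n}) (a : 'I_n -> nat) (i : 'I_n) :
  i \in S -> (dyson_exp S a i + a i)%N = (\sum_(j in S) a j)%N.
Proof. by move=> iS; rewrite mnmE iS [RHS](bigD1 i) //= addnC. Qed.

Lemma homog_dyson (R : comNzRingType) (n : nat) (q : R) (S : {set 'I_n})
    (a : 'I_n -> nat) :
  dyson q S a \is (mdeg (dyson_exp S a)).-homog.
Proof.
have -> : mdeg (dyson_exp S a) =
    (\sum_(i in S) \sum_(j in S | (i < j)%N) (a i + a j))%N.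
  rewrite mdegE; under eq_bigr => i _ do rewrite mnmE.
  rewrite -big_mkcond /=; under [RHS]eq_bigr => i _ do rewrite big_split /=.
  under eq_bigr => i _ do rewrite (bigID (fun j : 'I_n => (j < i)%N)) /=.
  rewrite !big_split /=; congr addn.
    rewrite (exchange_big_dep (fun j => j \in S)) /= => [|i j _ /andP[/andP[]]//].
    apply: eq_bigr => i iS; apply: eq_bigl => j.
    by rewrite iS /= neq_ltn; case: ltngtP; rewrite ?andbT ?andbF.
  apply: eq_bigr => i iS; apply: eq_bigl => j.
  by rewrite neq_ltn; case: ltngtP; rewrite ?andbT ?andbF.
apply: homog_bigprod => i _; apply: homog_bigprod => j _.
exact: homog_dyson_pair.
Qed.

Lemma meval_dyson (R : comNzRingType) (n : nat) (q : R) (S : {set 'I_n})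
    (a : 'I_n -> nat) (x : 'I_n -> R) :
  (dyson q S a).@[x] =
  \prod_(i in S) \prod_(j in S | (i < j)%N) dyson_pair q (x i) (x j) (a i) (a j).
Proof.
rewrite rmorph_prod; apply: eq_bigr => i _; rewrite rmorph_prod.
by apply: eq_bigr => j _; rewrite rmorph_dyson_pair /= mevalC !mevalXU.
Qed.

(** The first product vanishes when y - x lies in [0, a), the second when x - y lies in [1, b]. This
    asymmetry is the source of the extra gap in [separated]. *)
Lemma dyson_pair_neq0 (R : comNzRingType) (q : R) (x y a b : nat) :
  dyson_pair q (q ^+ x) (q ^+ y) a b <> 0 ->
  ((x <= y -> x + a <= y) /\ (y < x -> y + b < x))%N.
Proof.
move=> nz; split=> lt; rewrite leqNgt; apply/negP => gt; apply: nz.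
- have lt_t : (y - x < a)%N by move: lt gt; lia.
  rewrite /dyson_pair (bigD1 (Ordinal lt_t)) //= -exprD subnKC //.
  by rewrite subrr !mul0r.
- have lt_t : ((x - y).-1 < b)%N by move: lt gt; lia.
  rewrite /dyson_pair mulrC (bigD1 (Ordinal lt_t)) //= -exprD.
  have -> : (y + (x - y).-1.+1 = x)%N by move: lt; lia.
  by rewrite subrr !mul0r.
Qed.

Lemma dyson_separated (R : idomainType) (n : nat) (q : R) (S : {set 'I_n})
    (a al : 'I_n -> nat) :
  (dyson q S a).@[fun i => q ^+ al i] != 0 -> separated S a al.
Proof.
rewrite meval_dyson => /prodf_neq0 nz i j iS jS lt_key.
have [lt_ij|lt_ji|/val_inj E] := ltngtP i j; last by rewrite E ltnn in lt_key.
- have /prodf_neq0/(_ j) := nz i iS; rewrite jS lt_ij /=.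
  move=> /(_ isT)/eqP/dyson_pair_neq0[+ _]; rewrite addn0; apply.
  by case: (lexkey_ltP lt_key) => [/ltnW|[->]].
- have /prodf_neq0/(_ i) := nz j jS; rewrite iS lt_ji /=.
  move=> /(_ isT)/eqP/dyson_pair_neq0[_]; rewrite addn1; apply.
  by case: (lexkey_ltP lt_key) => // -[_]; rewrite ltnNge ltnW.
Qed.

Lemma big_ltnS (R : Type) (idx : R) (op : Monoid.com_law idx) (n : nat)
    (P : pred 'I_n) (k : 'I_n) (G : 'I_n -> R) :
  \big[op/idx]_(i | P i && (i < k.+1)%N) G i =
  op (\big[op/idx]_(i | P i && (i < k)%N) G i) (if P k then G k else idx).
Proof.
case: ifP => Pk.
  rewrite (bigD1 k) ?Pk ?ltnSn //= Monoid.mulmC; congr (op _ _).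
  apply: eq_bigl => i; rewrite -andbA; congr andb.
  by rewrite ltnS ltn_neqAle andbC.
rewrite Monoid.mulm1; apply: eq_bigl => i; case Pi: (P i) => //=.
rewrite ltnS leq_eqVlt; case: eqP => // /val_inj E.
by rewrite -E Pi in Pk.
Qed.

(** * Intervals stacked in index order and the q-Dyson identity *)

Definition offset (n : nat) (S : {set 'I_n}) (a : 'I_n -> nat) (r : nat) : nat :=
  (\sum_(i in S | (i < r)%N) a i)%N.

Lemma offsetS (n : nat) (S : {set 'I_n}) (a : 'I_n -> nat) (k : 'I_n) :
  offset S a k.+1 = (offset S a k + (if k \in S then a k else 0))%N.
Proof. exact: big_ltnS. Qed.

Lemma offset0 (n : nat) (S : {set 'I_n}) (a : 'I_n -> nat) : offset S a 0 = 0%N.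
Proof. by rewrite /offset big_pred0 // => i; rewrite andbF. Qed.

Lemma offsetn (n : nat) (S : {set 'I_n}) (a : 'I_n -> nat) :
  offset S a n = (\sum_(i in S) a i)%N.
Proof. by apply: eq_bigl => i; rewrite ltn_ord andbT. Qed.

Lemma leq_offset (n : nat) (S : {set 'I_n}) (a : 'I_n -> nat) (r1 r2 : nat) :
  (r1 <= r2)%N -> (offset S a r1 <= offset S a r2)%N.
Proof.
move=> le12; rewrite /offset big_mkcondr [X in (_ <= X)%N]big_mkcondr /=.
by apply: leq_sum => i _; case: ifP => // /leq_trans/(_ le12) ->.
Qed.

Lemma big_nat_ord (R : Type) (idx : R) (op : Monoid.law idx) (p r : nat)
    (g : nat -> R) :
  \big[op/idx]_(p <= s < r) g s = \big[op/idx]_(t < r - p) g (p + t)%N.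
Proof.
rewrite -[X in index_iota X _]add0n big_addn big_mkord.
by apply: eq_bigr => t _; rewrite addnC.
Qed.

(** Stacked intervals are contiguous, so the double product runs once through a single integer
    interval. *)
Lemma prod_concat (R : comNzRingType) (n : nat) (S : {set 'I_n})
    (a : 'I_n -> nat) (g : nat -> R) (r1 r2 : nat) :
  (r1 <= r2 <= n)%N ->
  \prod_(i in S | (r1 <= i < r2)%N) \prod_(t < a i) g (offset S a i + t)%N =
  \prod_(offset S a r1 <= s < offset S a r2) g s.
Proof.
move=> /andP[]; elim: r2 => [|r IHr] le_r1r le_rn.
  by rewrite (big_geq (leq_offset _ _ _)) // big1 // => i; rewrite ltn0 !andbF.
move: le_r1r; rewrite leq_eqVlt => /predU1P[->|]; last rewrite ltnS => le_r1r.
  by rewrite big_geq // big1 // => i /and3P[_ ? ?]; lia.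
pose k := Ordinal le_rn; have kr : r = k by [].
under eq_bigl => i do rewrite andbA.
rewrite kr big_ltnS offsetS /=.
under eq_bigl => i do rewrite -andbA.
rewrite IHr ?(ltnW le_rn) // le_r1r andbT; case: ifP => kS; last first.
  by rewrite mulr1 addn0.
rewrite [RHS](@big_cat_nat _ _ _ (offset S a r)) ?leq_addr ?leq_offset //=.
by congr (_ * _); rewrite big_nat_ord addKn.
Qed.

Lemma qpoch_addn (R : comNzRingType) (q : R) (a b : nat) :
  qpoch q q (a + b) = qpoch q q a * \prod_(t < b) (1 - q ^+ (a + t).+1).
Proof.
rewrite /qpoch big_split_ord /=; congr (_ * _).
by apply: eq_bigr => t _; rewrite exprS.
Qed.

Lemma qpoch_neq0 (K : fieldType) (q : K) (a : nat) :
  (forall k, (0 < k)%N -> q ^+ k <> 1) -> qpoch q q a != 0.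
Proof.
move=> hq; apply/prodf_neq0 => i _; rewrite -exprS subr_eq0 eq_sym.
exact/eqP/hq.
Qed.

Lemma inj_expr_neq1 (K : fieldType) (q : K) :
  injective (fun i : nat => q ^+ i) -> forall k, (0 < k)%N -> q ^+ k <> 1.
Proof. by move=> inj k k_gt0 E; have := inj k 0%N E; move: k_gt0; lia. Qed.

(** A telescoping product, stated without division: the end of each interval is the offset of the
    next index. *)
Lemma prod_qpoch_telescope (R : comNzRingType) (n : nat) (q : R)
    (S : {set 'I_n}) (a : 'I_n -> nat) (N r : nat) : (r <= n)%N ->
  (\prod_(i in S | (i < r)%N) qpoch q q (N - offset S a i)) *
    qpoch q q (N - offset S a r) =
  qpoch q q N * \prod_(i in S | (i < r)%N) qpoch q q (N - offset S a i.+1).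
Proof.
elim: r => [|r IHr] le_rn.
  by rewrite !big_pred0 ?offset0 ?subn0 ?mulr1 ?mul1r // => i; rewrite andbF.
pose k := Ordinal le_rn; have kr : r = k by [].
have := IHr (ltnW le_rn); rewrite kr !big_ltnS /=; case: ifP => kS.
  by move=> E; rewrite E mulrA.
by rewrite !mulr1 [offset S a r.+1](offsetS S a k) kS addn0.
Qed.

(** The numerator of the Lagrange basis polynomial at q^b for the nodes q^0, ..., q^(b+L). *)
Definition lagrange_factor (R : comNzRingType) (q x : R) (b L : nat) : R :=
  (\prod_(s < b) (x - q ^+ s)) * \prod_(t < L) (x - q ^+ (b + t).+1).

(** Grouped by the larger index, the first halves of the pair factors give the left halves [A] of
    the Lagrange factors. Grouped by the smaller index, the second halves give products [B] that are
    the right halves with exponents shifted by [a i]; the resulting q-binomials telescope to a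
    q-multinomial. *)
Lemma dyson_eval_offset (K : fieldType) (n : nat) (q : K) (S : {set 'I_n})
    (a : 'I_n -> nat) :
  (forall k, (0 < k)%N -> q ^+ k <> 1) ->
  (dyson q S a).@[fun i : 'I_n => q ^+ offset S a i] *
    \prod_(i in S) qpoch q q (a i) =
  qpoch q q (\sum_(i in S) a i) *
  \prod_(i in S) lagrange_factor q (q ^+ offset S a i) (offset S a i)
     (dyson_exp S a i - offset S a i).
Proof.
move=> hq; pose N := (\sum_(i in S) a i)%N.
pose L (i : 'I_n) := (N - offset S a i.+1)%N.
pose A (j : 'I_n) := \prod_(s < offset S a j) (q ^+ offset S a j - q ^+ s).
pose B (i : 'I_n) := \prod_(t < L i) (q ^+ offset S a i - q ^+ (offset S a i.+1 + t).+1).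
have le_iN (i : 'I_n) : (offset S a i.+1 <= N)%N by rewrite /N -offsetn leq_offset.
have AE j : j \in S -> \prod_(i in S | (i < j)%N) \prod_(t < a i)
    (q ^+ offset S a j - q ^+ offset S a i * q ^+ t) = A j.
  move=> jS; have le_jn : (0 <= j <= n)%N by rewrite /= ltnW.
  have := prod_concat S a (fun s => q ^+ offset S a j - q ^+ s) le_jn.
  rewrite offset0 big_mkord; apply: etrans.
  by apply: eq_bigr => i _; apply: eq_bigr => t _; rewrite exprD.
have BE i : i \in S -> \prod_(j in S | (i < j)%N) \prod_(t < a j)
    (q ^+ offset S a i - q ^+ offset S a j * q ^+ t.+1) = B i.
  move=> iS; have le_in : (i.+1 <= n <= n)%N by rewrite ltn_ord leqnn.
  have := prod_concat S a (fun s => q ^+ offset S a i - q ^+ s.+1) le_in.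
  rewrite big_nat_ord offsetn; apply: etrans.
  apply: eq_big => [j|j _]; first by rewrite ltn_ord andbT.
  by apply: eq_bigr => t _; rewrite -exprD addnS.
have -> : (dyson q S a).@[fun i : 'I_n => q ^+ offset S a i] =
    (\prod_(i in S) A i) * \prod_(i in S) B i.
  rewrite meval_dyson /dyson_pair.
  under eq_bigr => i _ do rewrite big_split /=.
  rewrite big_split /=; congr (_ * _); last exact: eq_bigr.
  rewrite (exchange_big_dep (fun j => j \in S)) /= => [|i j _ /andP[]//].
  apply: eq_bigr => j jS; rewrite -AE //.
  by apply: eq_bigl => i; rewrite jS.
(* After extracting the power of q from each factor 1 - q^c, c runs over (a i, a i + L i] in [B i]
   and over [1, L i] in the Lagrange half, so their quotient is a q-binomial. *)
have key i : i \in S -> B i * qpoch q q (a i) * qpoch q q (L i) =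
    (\prod_(t < dyson_exp S a i - offset S a i)
       (q ^+ offset S a i - q ^+ (offset S a i + t).+1)) *
    qpoch q q (N - offset S a i).
  move=> iS; have oS := offsetS S a i; rewrite iS in oS.
  have -> : (dyson_exp S a i - offset S a i = L i)%N.
    by rewrite /L oS /N -(dyson_exp_addn a iS) subnDr.
  have -> : (N - offset S a i = a i + L i)%N.
    by have := le_iN i; rewrite /L oS; lia.
  rewrite qpoch_addn /B /qpoch.
  rewrite (eq_bigr (fun t : 'I_(L i) =>
      q ^+ offset S a i * (1 - q ^+ (a i + t).+1))) => [|t _]; last first.
    by rewrite mulrBr mulr1 -exprD oS; congr (_ - q ^+ _); lia.
  rewrite [in RHS](eq_bigr (fun t : 'I_(L i) =>
      q ^+ offset S a i * (1 - q * q ^+ t))) => [|t _]; last first.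
    by rewrite mulrBr mulr1 -exprS -exprD; congr (_ - q ^+ _); lia.
  by rewrite !big_split /=; ring.
have nzL : \prod_(i in S) qpoch q q (L i) != 0.
  by apply/prodf_neq0 => i _; apply: qpoch_neq0.
have keyP : (\prod_(i in S) B i) * (\prod_(i in S) qpoch q q (a i)) *
      (\prod_(i in S) qpoch q q (L i)) =
    (\prod_(i in S) \prod_(t < dyson_exp S a i - offset S a i)
       (q ^+ offset S a i - q ^+ (offset S a i + t).+1)) *
    (qpoch q q N * \prod_(i in S) qpoch q q (L i)).
  have := prod_qpoch_telescope q S a N (leqnn n).
  rewrite offsetn subnn [qpoch q q 0]big_ord0 mulr1.
  have ltn_all (G : 'I_n -> K) :
      \prod_(i in S | (i < n)%N) G i = \prod_(i in S) G i.
    by apply: eq_bigl => i; rewrite ltn_ord andbT.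
  by rewrite !ltn_all => <-; rewrite -!big_split /=; apply: eq_bigr.
apply: (mulIf nzL); rewrite /lagrange_factor big_split /= -/N.
by rewrite -!mulrA [X in _ * X]mulrA keyP -/(A _); ring.
Qed.

Lemma mnm_sum_U (n : nat) (S : {set 'I_n}) (d : 'I_n -> nat) (j : 'I_n) :
  (\sum_(i in S) U_(i) *+ d i)%MM j = (if j \in S then d j else 0)%N.
Proof.
rewrite mnm_sumE; under eq_bigr => i _ do rewrite mulmnE mnm1E.
case: ifP => jS; last first.
  by rewrite big1 // => i iS; case: eqP => [E|]; rewrite ?mul0n // -E iS in jS *.
rewrite (bigD1 j) //= eqxx mul1n big1 ?addn0 // => i /andP[_ /negbTE->].
by rewrite mul0n.
Qed.

(** The scalar 1 gives each factor the shape required by [has_top_linear]. *)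
Definition lagrange_mpoly (R : comNzRingType) (n : nat) (q : R) (i : 'I_n)
    (b L : nat) : {mpoly R[n]} :=
  (\prod_(s < b) (1 *: 'X_i - (q ^+ s)%:MP)) *
  \prod_(t < L) (1 *: 'X_i - (q ^+ (b + t).+1)%:MP).

Lemma meval_lagrange (R : comNzRingType) (n : nat) (q : R) (i : 'I_n)
    (b L : nat) (x : 'I_n -> R) :
  (lagrange_mpoly q i b L).@[x] = lagrange_factor q (x i) b L.
Proof.
rewrite /lagrange_mpoly rmorphM !rmorph_prod /=.
by congr (_ * _); apply: eq_bigr => t _;
  rewrite rmorphB /= mevalZ mul1r mevalXU mevalC.
Qed.

Lemma has_top_lagrange (R : comNzRingType) (n : nat) (q : R) (i : 'I_n)
    (b L : nat) Q d c :
  has_top Q d c ->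
  has_top (Q * lagrange_mpoly q i b L) (d + U_(i) *+ (b + L))%MM (1 * c).
Proof.
move=> topQ.
have -> : (U_(i) *+ (b + L) = U_(i) *+ b + U_(i) *+ L)%MM.
  by apply/mnmP => j; rewrite mnmDE !mulmnE mulnDr.
rewrite addmA mulrA.
have := has_top_linears i 1 (fun t => q ^+ (b + t).+1) L
  (has_top_linears i 1 (fun s => q ^+ s) b topQ).
by rewrite !expr1n !mul1r.
Qed.

Lemma lagrange_factor_eq0 (R : comNzRingType) (q : R) (x b L : nat) :
  (x <= b + L)%N -> x <> b -> lagrange_factor q (q ^+ x) b L = 0.
Proof.
move=> le_x ne_x; rewrite /lagrange_factor; have [lt_xb|lt_bx|//] := ltngtP x b.
  by rewrite (bigD1 (Ordinal lt_xb)) //= subrr !mul0r.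
have lt_t : (x - b.+1 < L)%N by move: le_x lt_bx; lia.
rewrite mulrC (bigD1 (Ordinal lt_t)) //= -addSn subnKC //.
by rewrite subrr !mul0r.
Qed.

Lemma lagrange_factor_neq0 (K : fieldType) (q : K) (b L : nat) :
  injective (fun i : nat => q ^+ i) -> lagrange_factor q (q ^+ b) b L != 0.
Proof.
move=> inj_q; rewrite /lagrange_factor mulf_neq0 //; apply/prodf_neq0 => t _;
  rewrite subr_eq0 (inj_eq inj_q).
  by rewrite gtn_eqF.
by rewrite ltn_eqF // ltnS leq_addr.
Qed.

(* The q-Dyson identity for the variables indexed by [S]: on the grid the
   Dyson product is nonzero at a single point, where the intervals are stacked
   in increasing order of index. *)
Lemma qdyson (K : fieldType) (n : nat) (q : K) (S : {set 'I_n}) (a : 'I_n -> nat) :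
  injective (fun i : nat => q ^+ i) ->
  (dyson q S a)@_(dyson_exp S a) * \prod_(i in S) qpoch q q (a i) =
  qpoch q q (\sum_(i in S) a i).
Proof.
move=> inj_q; have hq := inj_expr_neq1 inj_q.
pose e := dyson_exp S a; pose o (i : 'I_n) := offset S a i.
have le_oe i : i \in S -> (o i <= e i)%N.
  move=> iS; have := dyson_exp_addn a iS; rewrite -/e -offsetn.
  have := leq_offset S a (ltn_ord i); rewrite offsetS iS -/(o i).
  by move: (o i) (e i) (offset S a n); lia.
pose ps := \prod_(i in S) lagrange_mpoly q i (o i) (e i - o i).
have topP : has_top ps e 1.
  have := has_top_fun (index_enum 'I_n) (P := fun i => i \in S)
    (G := fun i => lagrange_mpoly q i (o i) (e i - o i))
    (E := fun i => (U_(i) *+ (o i + (e i - o i)))%MM) (b := fun=> 1)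
    (fun i Q d c _ => @has_top_lagrange _ _ _ _ _ _ Q d c) (@has_top1 K n).
  rewrite mul1r add0m big1_eq mulr1; congr has_top.
  apply/mnmP => j; rewrite mnm_sum_U /e; case: ifP => jS.
    by rewrite subnKC // le_oe.
  by rewrite mnmE jS.
(* This scaling matches the two polynomials at the stacked point; as [ps] has top coefficient 1, [c]
   is the coefficient sought. *)
pose c := (dyson q S a).@[fun i : 'I_n => q ^+ o i] / ps.@[fun i => q ^+ o i].
have psE (al : 'I_n -> nat) : ps.@[fun i => q ^+ al i] =
    \prod_(i in S) lagrange_factor q (q ^+ al i) (o i) (e i - o i).
  by rewrite rmorph_prod; apply: eq_bigr => i _; rewrite /= meval_lagrange.
have nz_ps : ps.@[fun i => q ^+ o i] != 0.
  by rewrite psE; apply/prodf_neq0 => i _; apply: lagrange_factor_neq0.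
have -> : (dyson q S a)@_e = c * 1.
  apply: (has_top_coef_eq inj_q _ (has_topZ c topP)) => [|al le_al].
    split=> //; apply: msize_le => h h_in.
    by rewrite (dhomog_mf (homog_dyson q S a) h_in).
  have [/forall_inP al_o|] := boolP [forall i in S, al i == o i].
    rewrite mevalZ !meval_dyson psE.
    have -> : \prod_(i in S) lagrange_factor q (q ^+ al i) (o i) (e i - o i) =
        ps.@[fun i => q ^+ o i].
      by rewrite psE; apply: eq_bigr => i /al_o/eqP->.
    rewrite /c divfK // meval_dyson.
    by apply: eq_bigr => i /al_o/eqP->; apply: eq_bigr => j /andP[/al_o/eqP-> _].
  rewrite negb_forall_in => /existsP[i /andP[iS /eqP ne_i]].
  rewrite mevalZ psE (bigD1 i) //= lagrange_factor_eq0 ?mul0r ?mulr0 //; last first.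
    by rewrite subnKC // le_oe.
  apply/eqP/negPn/negP => /dyson_separated sep; apply: ne_i.
  (* The grid bound [al j <= e j] says that the interval of [j] ends within the total length. *)
  apply: (separated_position sep) => // j jS.
  by rewrite -(dyson_exp_addn a jS) leq_add2r.
rewrite mulr1 mulrAC dyson_eval_offset // mulrC.
by rewrite psE mulrC mulfK // -psE.
Qed.

(** * Vanishing *)

Definition mqalphabet (R : comNzRingType) (n : nat) (q : R) (a : 'I_n -> nat) :
    seq {mpoly R[n]} :=
  [seq 'X_i * (q ^+ j)%:MP | i <- enum 'I_n, j <- iota 0 (a i)].

Definition dcoef_exp (n : nat) (v a : 'I_n -> nat) : 'X_{1..n} :=
  [multinom (v i + dyson_exp [set: 'I_n] a i)%N | i < n].

(** The polynomial form of [Dcoef], defined over any commutative ring so that it can be formed over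
    [{poly F}] and specialised. *)
Definition dcoef (R : comNzRingType) (n : nat) (q : R) (v : 'I_n -> nat) (m : nat)
    (a : 'I_n -> nat) : R :=
  (hsym m (mqalphabet q a) * dyson q [set: 'I_n] a)@_(dcoef_exp v a).

Lemma homog_mqalphabet (R : comNzRingType) (n : nat) (q : R) (a : 'I_n -> nat) :
  {in mqalphabet q a, forall x, x \is 1.-homog}.
Proof.
move=> x /allpairsPdep[i [t [_ _ ->]]]; rewrite mulrC mul_mpolyC.
have homX : 'X_i \is [in R[n], 1.-homog] by rewrite dhomogX /= mdeg1.
exact: rpredZ.
Qed.

Lemma mdeg_dcoef_exp (n : nat) (v a : 'I_n -> nat) :
  mdeg (dcoef_exp v a) = (\sum_i v i + mdeg (dyson_exp [set: 'I_n] a))%N.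
Proof.
rewrite !mdegE -big_split /=.
by apply: eq_bigr => i _; rewrite !mnmE.
Qed.

(** The product is homogeneous, and the monomial has the wrong degree. *)
Lemma dcoef_degree_neq (R : comNzRingType) (n : nat) (q : R) (v : 'I_n -> nat)
    (m : nat) (a : 'I_n -> nat) :
  (\sum_i v i)%N <> m -> dcoef q v m a = 0.
Proof.
move=> ne_m; apply: (@dhomog_nemf_coeff _ _ mdeg
    (m + mdeg (dyson_exp [set: 'I_n] a))); last first.
  by rewrite /= mdeg_dcoef_exp eqn_add2r; apply/eqP.
apply/dhomogM/homog_dyson; rewrite hsym_geom.
exact/homog_coef_prod_geom/homog_mqalphabet.
Qed.

Lemma big_strings (R : Type) (idx : R) (op : Monoid.com_law idx) (n : nat)
    (a al : 'I_n -> nat) (G : nat -> R) :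
  \big[op/idx]_(x <- strings a al (enum 'I_n)) G x =
  \big[op/idx]_i \big[op/idx]_(t < a i) G (al i + t)%N.
Proof.
rewrite big_allpairs_dep /= big_enum; apply: eq_bigr => i _.
by rewrite -{1}[a i]subn0 -[iota _ _]/(index_iota 0 (a i)) big_mkord.
Qed.

Lemma size_strings (n : nat) (a al : 'I_n -> nat) :
  size (strings a al (enum 'I_n)) = (\sum_i a i)%N.
Proof. by rewrite -sum1_size big_strings; apply: eq_bigr => i _; rewrite sum1_card card_ord. Qed.

Definition gaps (s : seq nat) (M : nat) : seq nat :=
  [seq t <- iota 0 M | t \notin s].

Lemma perm_gaps (s : seq nat) (M : nat) :
  uniq s -> all (ltn^~ M) s -> perm_eq (iota 0 M) (s ++ gaps s M).
Proof.
move=> us /allP ltM; apply: uniq_perm; first exact: iota_uniq.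
  rewrite cat_uniq us filter_uniq ?iota_uniq // andbT.
  by apply/hasPn => t; rewrite mem_filter => /andP[].
move=> t; rewrite mem_cat mem_filter mem_iota /=.
by case: (boolP (t \in s)) => [/ltM|].
Qed.

Lemma size_gaps (s : seq nat) (M : nat) :
  uniq s -> all (ltn^~ M) s -> size (gaps s M) = (M - size s)%N.
Proof.
move=> us ltM; have /perm_size := perm_gaps us ltM.
by rewrite size_iota size_cat; move: (size s) (size (gaps s M)) => x y; lia.
Qed.

Definition qgrid (R : comNzRingType) (q : R) (M : nat) : seq R :=
  [seq q ^+ t | t <- iota 0 M].

(** Grid factors with exponent in [s] cancel the geometric series modulo X^(m+1), leaving those of
    the gaps. The factor [G] makes room for a letter outside the grid. *)
Lemma coef_geom_gaps (R : comNzRingType) (q : R) (m M : nat) (s : seq nat)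
    (G : {poly R}) : uniq s -> all (ltn^~ M) s ->
  ((G * \prod_(x <- s) geom m (q ^+ x)) * \prod_(b <- qgrid q M) (1 - b *: 'X))`_m =
  (G * \prod_(t <- gaps s M) (1 - q ^+ t *: 'X))`_m.
Proof.
move=> us ltM; rewrite big_map (perm_big _ (perm_gaps us ltM)) big_cat /=.
rewrite -[RHS](coef_prod_geomM m [seq q ^+ x | x <- s]) !big_map.
by congr (_`_m); congr polyseq; ring.
Qed.

Lemma coef_linears_eq0 (R : comNzRingType) (s : seq R) (j : nat) :
  (size s < j)%N -> (\prod_(b <- s) (1 - b *: 'X))`_j = 0.
Proof.
elim: s j => [|b s IHs] [|j] //= lt_sj; first by rewrite big_nil coef1.
rewrite big_cons mulrBl mul1r -scalerAl coefB coefZ coefXM /=.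
by rewrite !IHs ?mulr0 ?subr0 // ltnW.
Qed.

Lemma meval_hshift_strings (R : comNzRingType) (n : nat) (q : R) (m M : nat)
    (a al : 'I_n -> nat) :
  (hshift m (mqalphabet q a) (qgrid q M)).@[fun i => q ^+ al i] =
  ((\prod_(x <- strings a al (enum 'I_n)) geom m (q ^+ x)) *
     \prod_(b <- qgrid q M) (1 - b *: 'X))`_m.
Proof.
rewrite meval_hshift !big_allpairs_dep /=.
congr (_`_m); congr polyseq; congr (_ * _).
apply: eq_bigr => i _; apply: eq_bigr => t _.
by rewrite mevalM mevalXU mevalC -exprD.
Qed.

Lemma strings_lt (n : nat) (a al : 'I_n -> nat) (M : nat) :
  (forall i, 0 < a i -> al i + a i <= M)%N ->
  all (ltn^~ M) (strings a al (enum 'I_n)).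
Proof.
move=> bnd; apply/allP => x /allpairsPdep[i [t [_]]].
rewrite mem_iota add0n /= => lt_t ->; have := bnd i (leq_ltn_trans (leq0n t) lt_t).
by move: lt_t; lia.
Qed.

(** The strings fill |a| of the |a| + m - 1 places, so only m - 1 linear factors survive and their
    product has no term in X^m. *)
Lemma hshift_eq0 (R : comNzRingType) (n : nat) (q : R) (m : nat)
    (a al : 'I_n -> nat) : (0 < m)%N -> separated [set: 'I_n] a al ->
  (forall i, 0 < a i -> al i + a i <= \sum_j a j + m.-1)%N ->
  (hshift m (mqalphabet q a) (qgrid q (\sum_j a j + m.-1))).@[fun i => q ^+ al i] = 0.
Proof.
move=> m_gt0 sep bnd; rewrite meval_hshift_strings.
have us : uniq (strings a al (enum 'I_n)).
  by apply: (strings_uniq sep) => [|i _]; rewrite ?enum_uniq ?inE.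
have ltM := strings_lt bnd.
have := @coef_geom_gaps R q m _ _ 1 us ltM; rewrite !mul1r => ->.
have := @coef_linears_eq0 R [seq q ^+ t | t <- gaps (strings a al (enum 'I_n))
  (\sum_j a j + m.-1)] m.
rewrite big_map; apply; rewrite size_map size_gaps // size_strings addKn.
by rewrite prednK.
Qed.

Lemma has_top_dcoef (R : comNzRingType) (n : nat) (q : R) (v : 'I_n -> nat)
    (m : nat) (a : 'I_n -> nat) (B : seq R) : (\sum_i v i)%N = m ->
  has_top (hshift m (mqalphabet q a) B * dyson q [set: 'I_n] a) (dcoef_exp v a)
    (dcoef q v m a).
Proof.
move=> vm; apply: has_top_hshift (homog_dyson q _ a) _.
  exact: homog_mqalphabet.
by rewrite mdeg_dcoef_exp vm.
Qed.

Lemma dyson_exp_setT (n : nat) (a : 'I_n -> nat) (i : 'I_n) :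
  (dyson_exp [set: 'I_n] a i + a i)%N = (\sum_j a j)%N.
Proof.
by rewrite dyson_exp_addn ?inE //; apply: eq_bigl => j; rewrite inE.
Qed.

Lemma dcoef_eq0 (K : fieldType) (n : nat) (q : K) (v : 'I_n -> nat) (m : nat)
    (a : 'I_n -> nat) :
  injective (fun i : nat => q ^+ i) -> (0 < m)%N -> (\sum_i v i)%N = m ->
  (forall i, 0 < a i -> v i < m)%N -> dcoef q v m a = 0.
Proof.
move=> inj_q m_gt0 vm lt_v.
apply: (has_top_coef_eq inj_q (has_top_dcoef q a (qgrid q (\sum_j a j + m.-1)) vm)
   (d := 0) (Q := 0)) => [|al le_al].
  by split; rewrite ?msize0 ?mcoeff0.
rewrite meval0 mevalM.
have [->|/dyson_separated sep] := eqVneq (dyson q [set: 'I_n] a).@[fun i => q ^+ al i] 0.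
  by rewrite mulr0.
rewrite hshift_eq0 ?mul0r // => i a_gt0.
(* Here al i + a i <= v i + |a| and v i < m, so the string of [i] fits in the grid. *)
have := le_al i; rewrite mnmE; have := dyson_exp_setT a i; have := lt_v i a_gt0.
by move: (dyson_exp _ _ i) (al i) (v i) (a i) (\sum_j a j)%N; lia.
Qed.

(** * The one-part case *)

(** In terms of y/x both sides have the zeros q^(-b), ..., q^(a-1), a run cut in two at different
    places. Induction on [b] avoids inverting q. *)
Lemma dyson_pair_shift (R : comNzRingType) (q x y : R) (a b : nat) :
  dyson_pair q x y a b * q ^+ (a * b) =
  (\prod_(t < a) (q ^+ b * y - x * q ^+ t)) *
  \prod_(t < b) (q ^+ a * x - y * q ^+ t.+1).
Proof.
(* Raising the shift by one moves the run of zeros of the product by one place: one factor is gained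
   at one end and one lost at the other. *)
have step c : (x - y * q ^+ c.+1) * q ^+ a * \prod_(t < a) (q ^+ c * y - x * q ^+ t) =
    \prod_(t < a) (q ^+ c.+1 * y - x * q ^+ t) * (q ^+ a * x - y * q ^+ c.+1).
  elim: a => [|a IHa]; first by rewrite !big_ord0 expr0; ring.
  rewrite !big_ord_recr /=; move: IHa; set P1 := \prod_(t < a) _.
  set P2 := \prod_(t < a) _ => IHa.
  transitivity ((x - y * q ^+ c.+1) * q ^+ a * P1 * (q * (q ^+ c * y - x * q ^+ a))).
    by rewrite !exprS; ring.
  by rewrite IHa !exprS; ring.
rewrite /dyson_pair; elim: b => [|b IHb].
  rewrite !big_ord0 muln0 !mulr1; apply: eq_bigr => t _.
  by rewrite expr0 mul1r.
rewrite !big_ord_recr /= mulnS exprD.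
transitivity ((x - y * q ^+ b.+1) * q ^+ a *
  (\prod_(t < a) (y - x * q ^+ t) * \prod_(t < b) (x - y * q ^+ t.+1) * q ^+ (a * b))).
  by ring.
by rewrite IHb !mulrA step; ring.
Qed.

(** Relates the two orders of a pair, so that indices before and after [k] differ by one linear
    factor only. *)
Lemma dyson_pairC (R : comNzRingType) (q x y : R) (a b : nat) :
  dyson_pair q y x b.+1 a = dyson_pair q x y a b * (q ^+ a * x - y).
Proof.
rewrite /dyson_pair big_ord_recl /= expr0 mulr1.
have E : (y - x) * \prod_(t < a) (y - x * q ^+ t.+1) =
    \prod_(t < a) (y - x * q ^+ t) * (y - x * q ^+ a).
  have := big_ord_recl a (fun t => y - x * q ^+ t) : \prod_(t < a.+1) _ = _.
  by rewrite big_ord_recr /= expr0 mulr1 => <-.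
transitivity (- ((y - x) * \prod_(t < a) (y - x * q ^+ t.+1)) *
    \prod_(t < b) (x - y * q ^+ t.+1)); first by ring.
by rewrite E; ring.
Qed.

(* What remains of the pair factor of x_j and x_k = q^T once the factors
   vanishing when q^(T+b) lies in the q-string of x_j are removed; see
   [cofactor_pair]. *)
Definition cofactor (R : comNzRingType) (q y x : R) (b a : nat) (before : bool) : R :=
  (\prod_(t < b) (q ^+ a * x - y * q ^+ t.+1)) *
  (if before then x - y * q ^+ b.+1 else q ^+ a * x - y).

Lemma cofactor_pair (R : comNzRingType) (q y x : R) (b a : nat) (before : bool) :
  (if before then dyson_pair q x y a b.+1 else dyson_pair q y x b.+1 a) *
    q ^+ (a * b) =
  (\prod_(t < a) (q ^+ b * y - x * q ^+ t)) * cofactor q y x b a before.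
Proof.
rewrite /cofactor [RHS]mulrA -dyson_pair_shift; case: before.
  by rewrite /dyson_pair big_ord_recr /=; ring.
by rewrite dyson_pairC; ring.
Qed.

Lemma prod_pairs_split (R : comNzRingType) (n : nat) (k : 'I_n)
    (f : 'I_n -> 'I_n -> R) :
  \prod_(i in [set: 'I_n]) \prod_(j in [set: 'I_n] | (i < j)%N) f i j =
  (\prod_(i in [set~ k]) \prod_(j in [set~ k] | (i < j)%N) f i j) *
  \prod_(j in [set~ k]) (if (j < k)%N then f j k else f k j).
Proof.
rewrite (bigD1 k) ?inE //=.
under eq_bigl => j do rewrite inE.
under [X in _ * X]eq_bigl => i do rewrite in_setT /= -in_setC1.
have inner i : i \in [set~ k] ->
    \prod_(j in [set: 'I_n] | (i < j)%N) f i j =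
    (\prod_(j in [set~ k] | (i < j)%N) f i j) * (if (i < k)%N then f i k else 1).
  rewrite !inE => ne_ik; case: ifP => lt_ik.
    rewrite (bigD1 k) ?inE //= mulrC; congr (_ * _); apply: eq_bigl => j.
    by rewrite !inE andbC.
  rewrite mulr1; apply: eq_bigl => j; rewrite !inE.
  by case: eqP => // ->; rewrite lt_ik.
rewrite (eq_bigr _ inner) big_split /= mulrCA; congr (_ * _).
have -> : \prod_(j : 'I_n | true && (k < j)%N) f k j =
    \prod_(j in [set~ k]) (if (k < j)%N then f k j else 1).
  rewrite -big_mkcondr /=; apply: eq_bigl => j; rewrite !inE.
  by case: eqP => // ->; rewrite ltnn.
rewrite -big_split /=; apply: eq_bigr => j; rewrite !inE => ne_jk.
case: ltngtP => [lt|lt|/val_inj E]; rewrite ?mul1r ?mulr1 //.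
by rewrite E eqxx in ne_jk.
Qed.

(** Extract -q^s from each factor; the remaining 1 - q^(T+b-s), read backwards, extend the
    q-factorial of [b] to that of [T + b]. *)
Lemma prod_qgrid_diff (R : comNzRingType) (q : R) (T b : nat) :
  (\prod_(s < T) (q ^+ (T + b) - q ^+ s)) * qpoch q q b =
  (\prod_(s < T) (- q ^+ s)) * qpoch q q (T + b).
Proof.
rewrite addnC qpoch_addn mulrC mulrCA; congr (_ * _).
rewrite [X in _ = _ * X](reindex_inj rev_ord_inj) -big_split /=.
apply: eq_bigr => s _; rewrite mulrBr mulr1 mulNr opprK -exprD [RHS]addrC.
by congr (q ^+ _ - _); have := ltn_ord s; lia.
Qed.

(** The cofactor with x_k frozen at q^T, a product of b + 1 linear factors in x_j alone. *)
Definition cofactor_mpoly (R : comNzRingType) (n : nat) (q : R) (j : 'I_n)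
    (T b a : nat) (before : bool) : {mpoly R[n]} :=
  (\prod_(t < b) (q ^+ a *: 'X_j - (q ^+ T * q ^+ t.+1)%:MP)) *
  ((if before then 1 else q ^+ a) *: 'X_j -
   (if before then q ^+ T * q ^+ b.+1 else q ^+ T)%:MP).

Lemma meval_cofactor (R : comNzRingType) (n : nat) (q : R) (j : 'I_n)
    (T b a : nat) (before : bool) (x : 'I_n -> R) :
  (cofactor_mpoly q j T b a before).@[x] = cofactor q (q ^+ T) (x j) b a before.
Proof.
rewrite /cofactor_mpoly rmorphM rmorph_prod /=; congr (_ * _).
  by apply: eq_bigr => t _; rewrite mevalB mevalZ mevalXU mevalC.
by rewrite mevalB mevalZ mevalXU mevalC; case: before; rewrite ?mul1r.
Qed.

Lemma has_top_cofactor (R : comNzRingType) (n : nat) (q : R) (j : 'I_n)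
    (T b a : nat) (before : bool) Q d c :
  has_top Q d c ->
  has_top (Q * cofactor_mpoly q j T b a before) (d + U_(j) *+ b.+1)%MM
    ((if before then 1 else q ^+ a) * q ^+ (a * b) * c).
Proof.
move=> topQ; rewrite mulmSr addmA mulrA exprM -(mulrA (if _ then _ else _)).
exact: (has_top_linear _ _ _ (has_top_linears j _ (fun t => q ^+ T * q ^+ t.+1) _ topQ)).
Qed.

Lemma sum_setC1 (n : nat) (a : 'I_n -> nat) (k : 'I_n) :
  (\sum_j a j)%N = (\sum_(j in [set~ k]) a j + a k)%N.
Proof.
rewrite (bigD1 k) //= addnC; congr addn.
by apply: eq_bigl => j; rewrite !inE.
Qed.

(** The k-th string ends at exponent T + b, one step beyond the grid. After cancellation there
    remain m gaps and the series of c = q^(T+b), whence the product of c - q^t over the gaps; the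
    product on the left adds the other strings, which together with the gaps fill [0, T). *)
Lemma hshift_eval_top (K : fieldType) (n : nat) (q : K) (m b : nat)
    (a : 'I_n -> nat) (k : 'I_n) (al : 'I_n -> nat) (S := [set~ k])
    (M := (\sum_(j in S) a j)%N) (T := (M + m)%N) :
  injective (fun i : nat => q ^+ i) -> (0 < m)%N -> a k = b.+1 ->
  separated [set: 'I_n] a al -> al k = T ->
  (forall j, j \in S -> al j + a j <= M + b.+1)%N ->
  (hshift m (mqalphabet q a) (qgrid q (\sum_j a j + m.-1))).@[fun i => q ^+ al i] *
    \prod_(j in S) \prod_(t < a j) (q ^+ b * q ^+ T - q ^+ al j * q ^+ t) =
  \prod_(s < T) (q ^+ (T + b) - q ^+ s).
Proof.
move=> inj_q m_gt0 akE sep alk le_al.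
have sum_aE : (\sum_j a j)%N = (M + b.+1)%N by rewrite (sum_setC1 a k) akE.
have gridE : (\sum_j a j + m.-1)%N = (T + b)%N.
  by rewrite sum_aE /T; move: m_gt0; lia.
rewrite meval_hshift_strings gridE.
(* [a] with the last letter of the k-th string removed *)
pose a' (i : 'I_n) : nat := if i == k then b else a i.
pose s' := strings a' al (enum 'I_n).
have us : uniq s'.
  apply: (@strings_uniq _ [set: 'I_n]) => [i j iS jS lt_ij||i _];
    rewrite ?enum_uniq ?inE //.
  apply: leq_trans (sep i j iS jS lt_ij); rewrite leq_add2r leq_add2l /a'.
  by case: eqP => // ->; rewrite akE.
have ltM : all (ltn^~ (T + b)%N) s'.
  apply: strings_lt => i _; rewrite /a'; case: eqP => [->|/eqP ne_ik].
    by rewrite alk.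
  have : i \in S by rewrite !inE.
  by move/le_al => /leq_trans; apply; rewrite /T; move: m_gt0; lia.
have prodE (R : comNzRingType) (G : nat -> R) :
    \prod_(x <- strings a al (enum 'I_n)) G x = G (T + b)%N * \prod_(x <- s') G x.
  rewrite !big_strings (bigD1 k) //= [in RHS](bigD1 k) //= mulrA; congr (_ * _).
    by rewrite akE /a' eqxx big_ord_recr /= alk mulrC.
  by apply: eq_bigr => i /negbTE ne_ik; rewrite /a' ne_ik.
rewrite prodE coef_geom_gaps //.
have szg : size (gaps s' (T + b)) = m.
  rewrite size_gaps // size_strings (bigD1 k) //= /a' eqxx.
  rewrite (eq_bigr a) => [|i /negbTE->//].
  have := sum_aE; rewrite (bigD1 k) //= akE /T.
  by move: (\sum_(i | _) a i)%N; lia.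
rewrite -(big_map (fun t => q ^+ t) xpredT (fun c => 1 - c *: 'X)).
rewrite coef_geom_linears ?size_map szg ?leqnn // subnn mul1r big_map.
(* The factors at T, ..., T + b - 1, from the rest of the k-th string, are multiplied in so that
   gaps and [s'] make up the whole grid. *)
pose c := q ^+ (T + b).
have nz_c : \prod_(t < b) (c - q ^+ (T + t)) != 0.
  apply/prodf_neq0 => t _; rewrite subr_eq0 (inj_eq inj_q) eqn_add2l.
  by rewrite gtn_eqF.
have sE : \prod_(x <- s') (c - q ^+ x) =
    (\prod_(t < b) (c - q ^+ (T + t))) *
    \prod_(j in S) \prod_(t < a j) (q ^+ b * q ^+ T - q ^+ al j * q ^+ t).
  rewrite big_strings (bigD1 k) //= /a' eqxx alk; congr (_ * _).
  apply: eq_big => [i|i /negbTE ne_ik]; first by rewrite !inE.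
  rewrite ne_ik; apply: eq_bigr => t _.
  by rewrite /c -!exprD addnC.
apply: (mulIf nz_c); rewrite -mulrA [X in _ * X]mulrC -sE mulrC -big_cat /=.
rewrite -(perm_big _ (perm_gaps us ltM)) /= iotaD big_cat /= add0n.
congr (_ * _).
  by rewrite -[T in iota 0 T]subn0 -[iota _ _]/(index_iota 0 T) big_mkord.
have -> : iota T b = [seq (T + t)%N | t <- iota 0 b] by rewrite -iotaDl addn0.
by rewrite big_map -[b in iota 0 b]subn0 -[iota _ _]/(index_iota 0 b) big_mkord.
Qed.

(** Denominators are cleared so that the identity can be transported to polynomials in q. Here [b]
    is a_k - 1 and [T] is the exponent of x_k in the target monomial. *)
Lemma dcoef_one_part (K : fieldType) (n : nat) (q : K) (m b : nat)
    (a : 'I_n -> nat) (k : 'I_n) (v : 'I_n -> nat) (S := [set~ k])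
    (M := (\sum_(j in S) a j)%N) (T := (M + m)%N) :
  injective (fun i : nat => q ^+ i) -> (0 < m)%N -> a k = b.+1 ->
  (forall i, v i = if i == k then m else 0%N) ->
  dcoef q v m a *
    (qpoch q q b * qpoch q q T * \prod_(j in S) qpoch q q (a j)) =
  q ^+ (\sum_(j in S | (k < j)%N) a j) * qpoch q q (T + b) * qpoch q q M.
Proof.
move=> inj_q m_gt0 akE vE.
have sum_aE : (\sum_j a j)%N = (M + b.+1)%N by rewrite (sum_setC1 a k) akE.
have gridE : (\sum_j a j + m.-1)%N = (T + b)%N.
  by rewrite sum_aE /T; move: m_gt0; lia.
have vm : (\sum_i v i)%N = m.
  by rewrite (bigD1 k) //= vE eqxx big1 ?addn0 // => i /negbTE ne; rewrite vE ne.
have nz_q : q != 0.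
  by apply/eqP => q0; have := @inj_q 1 2; rewrite q0 !expr0n /= => /(_ erefl).
pose k1 := \prod_(s < T) (q ^+ (T + b) - q ^+ s).
pose k2 := lagrange_factor q (q ^+ T) T 0.
have nz_k2 : k2 != 0 by apply: lagrange_factor_neq0.
pose Q := \prod_(j in S) q ^+ (a j * b).
have nz_Q : Q != 0 by apply/prodf_neq0 => j _; rewrite expf_neq0.
pose l (j : 'I_n) := if (j < k)%N then 1 else q ^+ a j.
pose G := \prod_(j in S) cofactor_mpoly q j T b (a j) (j < k)%N.
(* The comparison polynomial: [k1] comes from [hshift_eval_top], [k2] is the value of the Lagrange
   numerator at x_k = q^T, and [Q] collects the powers of q from [cofactor_pair]. *)
pose P := (k1 / (k2 * Q)) *: (dyson q S a * G * lagrange_mpoly q k T 0).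
have expE : (dyson_exp S a + \sum_(j in S) U_(j) *+ b.+1 + U_(k) *+ (T + 0))%MM =
    dcoef_exp v a.
  apply/mnmP => i; rewrite !mnmDE mnm_sum_U mulmnE mnm1E [RHS]mnmE vE eq_sym addn0.
  have := dyson_exp_setT a i; rewrite sum_aE; case: eqP => [->|/eqP ne_ik].
    by rewrite [dyson_exp S a k]mnmE !inE eqxx akE /= /T; lia.
  have iS : i \in S by rewrite !inE.
  have := dyson_exp_addn a iS; rewrite iS -/M.
  by move: (dyson_exp S a i) (dyson_exp _ a i) (a i); rewrite /T; lia.
have topP : has_top P (dcoef_exp v a)
    (k1 / (k2 * Q) * (1 * ((\prod_(j in S) (l j * q ^+ (a j * b))) *
       (dyson q S a)@_(dyson_exp S a)))).
  rewrite -expE; apply/has_topZ/has_top_lagrange/has_top_fun => [j Q' d c _|].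
    exact: has_top_cofactor.
  split=> //; apply: msize_le => h h_in.
  by rewrite (dhomog_mf (homog_dyson q S a) h_in).
have -> : dcoef q v m a = k1 / k2 * (\prod_(j in S) l j) * (dyson q S a)@_(dyson_exp S a).
  rewrite (has_top_coef_eq inj_q
    (has_top_dcoef q a (qgrid q (\sum_j a j + m.-1)) vm) topP); last first.
    move=> al le_al; rewrite mevalM /P mevalZ [(_ * lagrange_mpoly _ _ _ _).@[_]]mevalM.
    rewrite meval_lagrange [(_ * G).@[_]]mevalM.
    have le_alk : (al k <= T)%N.
      have := le_al k; rewrite -expE !mnmDE mnm_sum_U mulmnE mnm1E eqxx !inE eqxx.
      by rewrite [dyson_exp S a k]mnmE !inE eqxx /= mul1n !addn0 !add0n.
    have le_alj j : j \in S -> (al j + a j <= M + b.+1)%N.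
      move=> jS; have := le_al j; rewrite mnmE vE.
      have := dyson_exp_setT a j; rewrite sum_aE.
      by move: jS; rewrite !inE => /negbTE->; move: (dyson_exp _ a j); lia.
    set D := (dyson q [set: 'I_n] a).@[_].
    (* If al k < T, the Lagrange factor vanishes on one side; on the other the k-th string fits in
       the grid, so [dyson] or [hshift] vanishes. *)
    have [alk|/eqP ne_alk] := eqVneq (al k) T; last first.
      rewrite [lagrange_factor _ _ _ _]lagrange_factor_eq0 ?addn0 // !mulr0.
      have [->|/dyson_separated sep] := eqVneq D 0; first by rewrite mulr0.
      rewrite hshift_eq0 ?mul0r // => i _; rewrite gridE.
      have [->|ne_ik] := eqVneq i k; first by rewrite akE; lia.
      have : i \in S by rewrite !inE.
      by move/le_alj => /leq_trans; apply; rewrite /T; move: m_gt0; lia.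
    rewrite alk -/k2; set h := (hshift _ _ _).@[_].
    set DS := (dyson q S a).@[_]; set Gv := G.@[_].
    pose Cz := \prod_(j in S) \prod_(t < a j) (q ^+ b * q ^+ T - q ^+ al j * q ^+ t).
    have DE : D * Q = DS * (Cz * Gv).
      rewrite /D meval_dyson (prod_pairs_split k) -/S -mulrA /DS meval_dyson.
      congr (_ * _); rewrite -big_split /= /Gv rmorph_prod /= -big_split /=.
      apply: eq_bigr => j _; rewrite akE alk meval_cofactor.
      by rewrite -cofactor_pair.
    (* The exponents al j + t stay below M + b + 1 <= T + b. *)
    have nz_Cz : Cz != 0.
      apply/prodf_neq0 => j jS; apply/prodf_neq0 => t _.
      rewrite -!exprD subr_eq0 (inj_eq inj_q).
      by have := le_alj j jS; have := ltn_ord t; rewrite /T; move: m_gt0; lia.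
    apply: (mulIf nz_Q).
    have -> : k1 / (k2 * Q) * (DS * Gv * k2) * Q = k1 * (DS * Gv).
      by field; rewrite nz_k2 nz_Q.
    rewrite -mulrA DE; have [D0|/dyson_separated sep] := eqVneq D 0.
      have : DS * Gv = 0.
        apply: (mulIf nz_Cz); rewrite mul0r -(mul0r Q) -D0 DE; ring.
      move=> DG0; rewrite DG0 mulr0.
      by rewrite [Cz * Gv]mulrC [DS * _]mulrA DG0 mul0r mulr0.
    have := hshift_eval_top inj_q m_gt0 akE sep alk le_alj; rewrite -/h -/Cz -/k1 => <-.
    by ring.
  by rewrite big_split /= -/Q; field; rewrite nz_k2 nz_Q.
(* The leading coefficients of the last cofactor factors produce the power of q; only indices after
   [k] contribute. *)
have lE : \prod_(j in S) l j = q ^+ (\sum_(j in S | (k < j)%N) a j).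
  rewrite -prodrXr big_mkcondr /=; apply: eq_bigr => j; rewrite /l !inE => ne_jk.
  by case: ltngtP ne_jk => // /val_inj->; rewrite eqxx.
have k1E : k1 / k2 * (qpoch q q b * qpoch q q T) = qpoch q q (T + b).
  have := prod_qgrid_diff q T b; have := prod_qgrid_diff q T 0.
  rewrite -/k1 addn0 [qpoch q q 0]big_ord0 mulr1.
  have -> : \prod_(s < T) (q ^+ T - q ^+ s) = k2.
    by rewrite /k2 /lagrange_factor big_ord0 mulr1.
  set u := \prod_(s < T) _ => k2E k1E; apply: (mulIf nz_k2).
  transitivity (k1 * qpoch q q b * qpoch q q T); first by field.
  by rewrite k1E k2E; ring.
rewrite lE -(qdyson S a inj_q) -k1E; ring.
Qed.

(** * Specialisation *)

Lemma rmorph_dcoef (R S : comNzRingType) (f : {rmorphism R -> S}) (n : nat) (q : R)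
    (v : 'I_n -> nat) (m : nat) (a : 'I_n -> nat) :
  f (dcoef q v m a) = dcoef (f q) v m a.
Proof.
rewrite /dcoef -mcoeff_map_mpoly rmorphM /= map_hsym.
congr ((hsym m _ * _)@_ _).
  rewrite /mqalphabet map_allpairs; apply: eq_allpairs => i t.
  rewrite rmorphM /= map_mpolyX map_mpolyC; congr (_ * mpolyC n _).
  exact: rmorphXn.
rewrite rmorph_prod; apply: eq_bigr => i _; rewrite rmorph_prod.
apply: eq_bigr => j _.
by rewrite rmorph_dyson_pair /= map_mpolyC !map_mpolyX.
Qed.

Lemma rmorph_qpoch (R S : comNzRingType) (f : {rmorphism R -> S}) (x q : R) (k : nat) :
  f (qpoch x q k) = qpoch (f x) (f q) k.
Proof.
rewrite rmorph_prod; apply: eq_bigr => i _.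
by rewrite rmorphB rmorph1 rmorphM rmorphXn.
Qed.

Lemma inj_tofrac_expX (F : fieldType) :
  injective (fun i : nat => FracField.tofrac ('X : {poly F}) ^+ i).
Proof.
move=> i j; rewrite -!rmorphXn => /eqP; rewrite tofrac_eq => /eqP.
by move/(congr1 (fun p : {poly F} => size p)); rewrite !size_polyXn => -[].
Qed.

(* The identities hold over F(X) at q = X, hence over F[X], hence at any q. *)
Lemma dcoef_eq0_at (F : fieldType) (n : nat) (q : F) (v : 'I_n -> nat) (m : nat)
    (a : 'I_n -> nat) :
  (0 < m)%N -> (\sum_i v i)%N = m -> (forall i, 0 < a i -> v i < m)%N ->
  dcoef q v m a = 0.
Proof.
move=> m_gt0 vm lt_v; rewrite -[q](hornerX q) -[_.[q]]/(horner_eval q _).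
rewrite -rmorph_dcoef; suff -> : dcoef ('X : {poly F}) v m a = 0 by rewrite rmorph0.
apply/eqP; rewrite -tofrac_eq0 rmorph_dcoef; apply/eqP.
exact: dcoef_eq0 (@inj_tofrac_expX F) _ _ _.
Qed.

Lemma dcoef_one_part_at (F : fieldType) (n : nat) (q : F) (m b : nat)
    (a v : 'I_n -> nat) (k : 'I_n) (M := (\sum_(j in [set~ k]) a j)%N) :
  (0 < m)%N -> a k = b.+1 -> (forall i, v i = if i == k then m else 0%N) ->
  dcoef q v m a *
    (qpoch q q b * qpoch q q (M + m) * \prod_(j in [set~ k]) qpoch q q (a j)) =
  q ^+ (\sum_(j in [set~ k] | (k < j)%N) a j) * qpoch q q (M + m + b) * qpoch q q M.
Proof.
move=> m_gt0 akE vE; pose X : {poly F} := 'X.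
suff : dcoef X v m a *
    (qpoch X X b * qpoch X X (M + m) * \prod_(j in [set~ k]) qpoch X X (a j)) =
  X ^+ (\sum_(j in [set~ k] | (k < j)%N) a j) * qpoch X X (M + m + b) * qpoch X X M.
  move/(congr1 (horner_eval q)); rewrite !rmorphM rmorphXn rmorph_dcoef !rmorph_qpoch.
  have qE : horner_eval q X = q by rewrite /horner_eval hornerX.
  by rewrite rmorph_prod /=; under eq_bigr do rewrite rmorph_qpoch /= qE; rewrite qE.
apply/eqP; rewrite -tofrac_eq; apply/eqP.
rewrite !rmorphM rmorphXn rmorph_dcoef !rmorph_qpoch rmorph_prod /=.
under eq_bigr => j _ do rewrite rmorph_qpoch.
exact: (dcoef_one_part (@inj_tofrac_expX F) m_gt0 akE vE).
Qed.

(** * From the Laurent constant term to a polynomial coefficient, and the closed formula *)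

Lemma prod_pairs_exp (R : comNzRingType) (n : nat) (a : 'I_n -> nat) (y : 'I_n -> R) :
  \prod_(i < n) \prod_(j < n | (i < j)%N) (y j ^+ a i * y i ^+ a j) =
  \prod_(i < n) y i ^+ dyson_exp [set: 'I_n] a i.
Proof.
under eq_bigr => i _ do rewrite big_split /=.
rewrite big_split /= (exchange_big_dep xpredT) //= -big_split /=.
apply: eq_bigr => i _; rewrite !prodrXr -exprD; congr (_ ^+ _).
rewrite mnmE in_setT [RHS](bigID (fun j : 'I_n => (j < i)%N)) /=; congr addn;
  apply: eq_bigl => j; rewrite inE /= neq_ltn; case: ltngtP => //.
Qed.

Lemma qpoch_div_pair (K : fieldType) (q x y : K) (a b : nat) :
  x != 0 -> y != 0 ->
  qpoch (x / y) q a * qpoch (q * y / x) q b =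
  dyson_pair q x y a b / (y ^+ a * x ^+ b).
Proof.
move=> nz_x nz_y.
have E c (z w u : K) (nz_w : w != 0) : qpoch (u * z / w) q c =
    (\prod_(t < c) (w - z * (u * q ^+ t))) / w ^+ c.
  have -> : w ^+ c = \prod_(t < c) w by rewrite prodr_const card_ord.
  rewrite -prodf_div; apply: eq_bigr => t _.
  by field.
rewrite -[x in x / y]mul1r !E // /dyson_pair.
rewrite (eq_bigr (fun t : 'I_a => y - x * q ^+ t)) => [|t _]; last by rewrite mul1r.
rewrite [X in _ * (X / _)](eq_bigr (fun t : 'I_b => x - y * q ^+ t.+1)) => [|t _].
  by field; rewrite !expf_neq0.
by rewrite exprS.
Qed.

(** Over a common denominator the Laurent polynomial becomes a polynomial divided by the monomial of
    exponent [dcoef_exp v a], and [CT_eq] applies. *)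
Lemma Dcoef_dcoef (F : fieldType) (n : nat) (q : F) (v : 'I_n -> nat) (m : nat)
    (a : 'I_n -> nat) :
  Dcoef q v m a = dcoef q v m a.
Proof.
rewrite /Dcoef /dcoef /= -CT_eq; congr CT.
have nz_x (i : 'I_n) : rf_var F i != 0 by apply: rf_ofX_neq0.
rewrite {1}/rf_of rmorphM /= map_hsym.
have -> : [seq FracField.tofrac x | x <- mqalphabet q a] = qalphabet q a.
  rewrite /mqalphabet map_allpairs; apply: eq_allpairs => i t.
  by rewrite rmorphM /= /rf_const /rf_of -rmorphXn /= rmorphXn.
have -> : FracField.tofrac (dyson q [set: 'I_n] a) =
   \prod_(i < n) \prod_(j < n | (i < j)%N)
     dyson_pair (rf_const n q) (rf_var F i) (rf_var F j) (a i) (a j).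
  rewrite rmorph_prod; apply: eq_big => [i|i _]; first by rewrite inE.
  rewrite rmorph_prod; apply: eq_big => [j|j _]; first by rewrite inE.
  by rewrite rmorph_dyson_pair.
have -> : \prod_(i < n) \prod_(j < n | (i < j)%N)
      (qpoch (rf_var F i / rf_var F j) (rf_const n q) (a i) *
       qpoch (rf_const n q * rf_var F j / rf_var F i) (rf_const n q) (a j)) =
    (\prod_(i < n) \prod_(j < n | (i < j)%N)
      dyson_pair (rf_const n q) (rf_var F i) (rf_var F j) (a i) (a j)) /
    \prod_(i < n) rf_var F i ^+ dyson_exp [set: 'I_n] a i.
  rewrite -prod_pairs_exp -prodf_div; apply: eq_bigr => i _.
  by rewrite -prodf_div; apply: eq_bigr => j _; rewrite qpoch_div_pair.
rewrite prodfV.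
have -> : rf_of ('X_[dcoef_exp v a] : {mpoly F[n]}) = (\prod_i rf_var F i ^+ v i) *
    \prod_i rf_var F i ^+ dyson_exp [set: 'I_n] a i.
  rewrite /rf_of mpolyXE_id rmorph_prod -big_split /=; apply: eq_bigr => i _.
  by rewrite mnmE exprD rmorphM !rmorphXn.
by rewrite invfM [_^-1 * hsym _ _]mulrC mulrACA.
Qed.

(** Used contrapositively: if the entries sum to [m] and v^+ is not (m), every entry is below [m],
    as [dcoef_eq0_at] requires. *)
Lemma plus_part_single (n : nat) (v : 'I_n -> nat) (m : nat) (k : 'I_n) :
  (0 < m)%N -> (\sum_i v i)%N = m -> (m <= v k)%N -> plus_part v = [:: m].
Proof.
move=> m_gt0; rewrite (bigD1 k) //= => vm le_mk.
have v0 i : i != k -> v i = 0%N.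
  by move=> ne; move: vm; rewrite (bigD1 i) //=; lia.
have vk : v k = m by rewrite big1 ?addn0 in vm.
rewrite /plus_part /codom /image_mem filter_map.
rewrite (@eq_filter _ _ (pred1 k)) => [|i /=].
  by rewrite filter_pred1_uniq ?enum_uniq ?mem_enum //= vk.
by case: (eqVneq i k) => [->|/v0->]; rewrite ?vk -?lt0n ?m_gt0 ?eqxx.
Qed.

Lemma qpoch_exprS (R : comNzRingType) (q : R) (c m : nat) :
  qpoch q q c * qpoch (q ^+ c.+1) q m = qpoch q q (c + m).
Proof.
rewrite qpoch_addn; congr (_ * _); apply: eq_bigr => t _.
by rewrite -exprD addSn.
Qed.

Theorem theorem1p3 (F : fieldType) (q : F)
  (hq : forall k : nat, (0 < k)%N -> q ^+ k <> 1)
  (n : nat) (hn : (0 < n)%N) (m : nat) (hm : (0 < m)%N)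
  (v a : 'I_n -> nat) :
  (plus_part v <> [:: m] -> Dcoef q v m a = 0) /\
  (forall k : 'I_n, (forall i : 'I_n, v i = if i == k then m else 0%N) ->
    Dcoef q v m a =
      (q ^+ (psum a n - psum a k.+1) * (1 - q ^+ a k) *
         qpoch (q ^+ psum a n) q m) /
      ((1 - q ^+ psum a n) * qpoch (q ^+ (psum a n - a k + 1)) q m) *
      (qpoch q q (psum a n) / \prod_(i < n) qpoch q q (a i))).
Proof.
rewrite !Dcoef_dcoef; split=> [ne_v|k vE].
  have [vm|/eqP] := eqVneq (\sum_i v i)%N m; last exact: dcoef_degree_neq.
  apply: dcoef_eq0_at => // i _; rewrite ltnNge; apply/negP => le_mv.
  exact/ne_v/(plus_part_single hm vm le_mv).
have vm : (\sum_i v i)%N = m.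
  by rewrite (bigD1 k) //= vE eqxx big1 ?addn0 // => i /negbTE ne; rewrite vE ne.
(* For a_k = 0 the right side contains 1 - q^0 = 0, and the left side vanishes because v i = 0 < m
   wherever a i > 0. *)
case ak: (a k) => [|b].
  rewrite expr0 subrr mulr0 !mul0r; apply: dcoef_eq0_at => // i ai_gt0.
  by rewrite vE; case: eqP => // ik; rewrite ik ak in ai_gt0.
have := dcoef_one_part_at q hm ak vE; set M := (\sum_(j in _) a j)%N => D_E.
have psumn : psum a n = (\sum_i a i)%N by apply: eq_bigl => i; rewrite ltn_ord.
have NE : psum a n = (M + b).+1.
  by rewrite psumn (sum_setC1 a k) ak addnS.
have tailE : (psum a n - psum a k.+1)%N = (\sum_(j in [set~ k] | (k < j)%N) a j)%N.
  rewrite psumn /psum (bigID (fun j : 'I_n => (j < k.+1)%N)) /= addKn.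
  apply: eq_bigl => j; rewrite !inE -leqNgt.
  by case: eqP => [->|]; rewrite ?ltnn.
have prodE : \prod_(i < n) qpoch q q (a i) =
    qpoch q q b * (1 - q ^+ b.+1) * \prod_(j in [set~ k]) qpoch q q (a j).
  rewrite (bigD1 k) //= ak {1}/qpoch big_ord_recr /= -exprS; congr (_ * _).
  by apply: eq_bigl => j; rewrite !inE.
have W1 := qpoch_exprS q (M + b) m; have W2 := qpoch_exprS q M m.
have W3 : qpoch q q (M + b).+1 = qpoch q q (M + b) * (1 - q ^+ (M + b).+1).
  by rewrite {1}/qpoch big_ord_recr /= -exprS.
(* Splitting off the last m factors of the q-factorials of M + b + m and M + m yields the shifted
   factorials at q^|a| and q^(|a| - a_k + 1). *)
rewrite -addnA [(m + b)%N]addnC addnA -W1 -W2 in D_E.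
rewrite tailE prodE NE W3.
have -> : ((M + b).+1 - b.+1 + 1 = M.+1)%N by lia.
have nzp c : qpoch q q c != 0 by apply: qpoch_neq0.
have nz1 c : 1 - q ^+ c.+1 != 0 by rewrite subr_eq0 eq_sym; apply/eqP/hq.
have nzS : \prod_(j in [set~ k]) qpoch q q (a j) != 0 by apply/prodf_neq0.
(* It divides the q-factorial of M + m, which is nonzero since no positive power of q is 1. *)
have nzW2 : qpoch (q ^+ M.+1) q m != 0.
  by apply: contra_neq (nzp (M + m)%N) => W0; rewrite -W2 W0 mulr0.
have nzD : qpoch q q b * (qpoch q q M * qpoch (q ^+ M.+1) q m) *
    \prod_(j in [set~ k]) qpoch q q (a j) != 0 by rewrite !mulf_neq0.
apply: (mulIf nzD); rewrite D_E; field.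
by rewrite !nz1 !nzp nzS nzW2.
Qed.
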